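(* If $1\le i\le n-2$, $e\in\mathrm{Swath}(i)\setminus\mathrm{Core}(i)$ and $$f(x):=-\ln c^*(e-x)-\frac{p^{(i)}_e(x)}{p^{(i+1)}_e(x)}\qquad\big(x\in\Lambda^{(i+1)}_{++,e},\ c^*(e-x)>0\big),$$ then $x^{(i)}_e$ is the unique optimal solution of the convex optimization problem $$\min_x f(x)\quad\text{s.t. } Ax=b .$$ Moreover, $D^2f(x^{(i)}_e)[v,v]>0$ if $v\in\mathcal{E}$ is not a scalar multiple of $x^{(i)}_e$ (in particular, if $v\ne0$ satisfies $Av=0$).
   Context: $\mathcal{E}$ is a finite-dimensional Euclidean space. $p:\mathcal{E}\to\mathbb{R}$ is a homogeneous polynomial of degree $n$ that is hyperbolic in some direction $e_0$: $p(e_0)>0$ and for every $x$ all roots of $t\mapsto p(x+te_0)$ are real. $\Lambda_{++}$ is the connected component of $\{p>0\}$ containing $e_0$, and $\Lambda_+$ is its closure. Known (Gårding): $\Lambda_{++}$ is convex and $p$ is hyperbolic in every direction $e\in\Lambda_{++}$. For $e\in\Lambda_{++}$ and $0\le i\le n-1$, $p_e^{(i)}(x):=D^ip(x)[e,\dots,e]$ ($i$ copies of $e$; $p_e^{(0)}=p$), which is hyperbolic in direction $e$ of degree $n-i$; $\Lambda^{(i)}_{++,e}$ is the connected component of $\{p_e^{(i)}>0\}$ containing $e$, and $\Lambda^{(i)}_{+,e}$ its closure. Standing assumptions: $\Lambda_+$ is regular (nonempty interior, contains no linear subspace other than $\{0\}$); $A:\mathcal{E}\to\mathbb{R}^m$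 is linear and surjective; $0\ne b\in\mathbb{R}^m$; $c^*$ is a linear functional on $\mathcal{E}$ not in the image of $A^*$ (i.e. not of the form $y^*A$). HP is the problem of minimizing $c^*x$ subject to $Ax=b$, $x\in\Lambda_+$; $\mathrm{Opt}$ is its set of optimal solutions. $\mathrm{HP}^{(i)}_e$ is the problem of minimizing $c^*x$ subject to $Ax=b$, $x\in\Lambda^{(i)}_{+,e}$, and $\mathrm{Opt}^{(i)}_e$ is its set of optimal solutions. For $0\le i\le n-1$, $\mathrm{Swath}(i):=\{e\in\Lambda_{++}: Ae=b,\ \mathrm{Opt}^{(i)}_e\ne\emptyset\}$ and $\mathrm{Core}(i):=\{e\in\mathrm{Swath}(i):\mathrm{Opt}^{(i)}_e=\mathrm{Opt}\}$. For $1\le i\le n-2$ and $e\in\mathrm{Swath}(i)\setminus\mathrm{Core}(i)$, the set $\mathrm{Opt}^{(i)}_e$ consists of exactly one point, denoted $x^{(i)}_e$. *)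

(* Defs.v *)
From HB Require Import structures.
From mathcomp Require Import all_boot all_order all_algebra.
From mathcomp Require Import all_classical all_reals all_analysis.
(* These notations clash with those of MathComp-Analysis. *)
From mathcomp Require Import -(notations) complex.
From mathcomp Require Import -(notations) mpoly.

Set Implicit Arguments.
Unset Strict Implicit.
Unset Printing Implicit Defensive.

Import Order.TTheory GRing.Theory Num.Theory.
Import numFieldNormedType.Exports.

Local Open Scope classical_set_scope.
Local Open Scope ring_scope.

(* The Euclidean space is R^d, as row vectors; the norm topology of the library
   is the Euclidean one, and the inner product itself plays no role. *)

Definition polyfun (R : realType) (d : nat) (P : mpoly d R) :
    'rV[R]_d -> R :=
  fun x => meval (fun j => x ord0 j) P.

Definition homogeneous (R : realType) (d n : nat) (P : mpoly d R) : Prop :=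
  P \is ishomog1 n mdeg.

(* [mmap] evaluates P, its coefficients being embedded in R[i], at the complex
   point x + t e; the roots t range over all complex numbers. *)
Definition hyperbolic (R : realType) (d : nat) (P : mpoly d R)
    (e : 'rV[R]_d) : Prop :=
  0 < polyfun P e /\
  forall (x : 'rV[R]_d) (t : complex R),
    mmap (real_complex R)
      (fun j => real_complex R (x ord0 j)
                + t * real_complex R (e ord0 j)) P = 0 ->
    complex.Im t = 0.

(* D^i p(x)[e, ..., e], with i copies of e, as an iterated directional
   derivative. *)
Definition dirD (R : realType) (d : nat) (p : 'rV[R]_d -> R) (i : nat)
    (e : 'rV[R]_d) : 'rV[R]_d -> R :=
  iter i (fun (g : 'rV[R]_d -> R) (x : 'rV[R]_d) => 'D_e (g : _ -> R^o) x) p.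

Definition open_cone (R : realType) (d : nat) (p : 'rV[R]_d -> R)
    (e : 'rV[R]_d) : set 'rV[R]_d :=
  connected_component [set x | 0 < p x] e.

Definition closed_cone (R : realType) (d : nat) (p : 'rV[R]_d -> R)
    (e : 'rV[R]_d) : set 'rV[R]_d :=
  closure (open_cone p e).

Definition regular_cone (R : realType) (d : nat) (K : set 'rV[R]_d) : Prop :=
  (interior K !=set0) /\
  forall L : {vspace 'rV[R]_d}, (forall x, x \in L -> K x) -> L = 0%VS.

Definition optimal (T : Type) (R : realType) (g : T -> R) (S : set T) : set T :=
  [set x | S x /\ forall y, S y -> g x <= g y].

Section HyperbolicProgram.
Variables (R : realType) (d m : nat) (p : 'rV[R]_d -> R) (e0 : 'rV[R]_d).
Variables (A : {linear 'rV[R]_d -> 'rV[R]_m}) (b : 'rV[R]_m).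
Variable c : {linear 'rV[R]_d -> R^o}.

Definition Opt : set 'rV[R]_d :=
  optimal c [set x | A x = b /\ closed_cone p e0 x].

Definition OptD (i : nat) (e : 'rV[R]_d) : set 'rV[R]_d :=
  optimal c [set x | A x = b /\ closed_cone (dirD p i e) e x].

Definition Swath (i : nat) : set 'rV[R]_d :=
  [set e | [/\ open_cone p e0 e, A e = b & OptD i e !=set0]].

Definition Core (i : nat) : set 'rV[R]_d :=
  [set e | Swath i e /\ OptD i e = Opt].

Definition swath_dom (i : nat) (e : 'rV[R]_d) : set 'rV[R]_d :=
  [set x | open_cone (dirD p i.+1 e) e x /\ 0 < c (e - x)].

(* Only the values on the open set [swath_dom i e] are meaningful. *)
Definition swath_fun (i : nat) (e x : 'rV[R]_d) : R :=
  - ln (c (e - x)) - dirD p i e x / dirD p i.+1 e x.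

End HyperbolicProgram.

Definition D2 (R : realType) (d : nat) (g : 'rV[R]_d -> R)
    (x v : 'rV[R]_d) : R := dirD g 2 v x.

(* Main.v *)
(* Let q be the i-th derivative of p in the direction e and q' = D_e q.

   By Garding's theorem hyperbolicity passes from e to every direction of the
   cone, so cones are convex and s |-> q(y + s w) is real-rooted for y in the
   cone of q. Applied to q(x) - r q'(x) in one more variable it shows that
   q/q' is concave, hence f is convex.

   At an optimal point x we have q(x) = 0, since c is not constant on ker A, and
   x is outside the cone of p, since e is not in the core; hence q'(x) > 0, for
   two consecutive vanishing derivatives would put x in the cone of p. If w is
   tangent at x, Newton's inequality for s |-> q(x + t e + s w), t -> 0, gives
   D^2 q(x)[w,w] <= 0, and in case of equality the same argument shows that q
   vanishes on the whole line x + R w. Modulo x one may take w with zero trace;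
   this line then leaves the cone of q, in both directions, at points where q
   has a double eigenvalue 0, which lie in the cone of p, and so would x, being
   between them. Hence w is a multiple of x, and D^2 f(x)[v,v] > 0 for every v
   that is not.

   Finally the first-order optimality condition at x, normalised by testing it
   with e - x, says that Df(x) vanishes on ker A. *)

Require Import Defs.
From HB Require Import structures.
From mathcomp Require Import all_boot all_order all_algebra.
From mathcomp Require Import all_classical all_reals all_analysis.
From mathcomp Require Import -(notations) complex.
From mathcomp Require Import -(notations) mpoly.
From mathcomp Require Import ring lra.

Set Implicit Arguments.
Unset Strict Implicit.
Unset Printing Implicit Defensive.

Import Order.TTheory GRing.Theory Num.Theory.
Import numFieldNormedType.Exports.

Local Open Scope classical_set_scope.
Local Open Scope ring_scope.

(** * Real-rooted polynomials *)

(** All the cones are read off one coefficient sequence, that of the real-rooted polynomial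
    [t |-> P (x + t e)]: differentiating along [e] shifts it, up to positive factors, so membership
    in the closed cone of the i-th derivative says that the coefficients of index at least i are
    nonnegative. Inclusions of cones are then immediate, and Newton's inequality relates
    neighbouring coefficients. The obstacle at the optimum is that [q x = 0]: [x] is not a direction
    of hyperbolicity, and [s |-> q (x + s w)] is not known to be real-rooted. Hence the detour
    through [x + t e]; every quantity there is a polynomial in [t], and those that vanish at 0 are
    divided by [t] before [t] tends to 0. *)

Section RootSeq.
Variable F : fieldType.
Implicit Types (s : seq F) (t z : F).

Lemma deriv_prod_XsubC s z :
  let P := \prod_(t <- s) ('X - t%:P) in
  P.[z] != 0 -> P^`().[z] = P.[z] * \sum_(t <- s) (z - t)^-1.
Proof.
elim: s => [|t s IHs] /=.
  by rewrite !big_nil -(polyC1) derivC !hornerC mulr0.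
rewrite !big_cons hornerM !hornerXsubC mulf_eq0 negb_or => /andP[u0 P0].
rewrite derivM derivXsubC hornerD !hornerM !hornerE IHs //.
by rewrite mulrDr mulrAC divff // mul1r mulrA.
Qed.

(** [W P] is [- P ^ 2] times the derivative of [P' / P]; the recursion builds it up as a sum of
    squares, root by root, without dividing by [P]. *)
Lemma newton_prod_XsubC s t z :
  let W (P : {poly F}) := P^`().[z] ^+ 2 - P.[z] * P^`()^`().[z] in
  let P := \prod_(t <- s) ('X - t%:P) in
  W (('X - t%:P) * P) = P.[z] ^+ 2 + (z - t) ^+ 2 * W P.
Proof.
move=> W P; rewrite /W !derivM derivXsubC mul1r derivD derivM derivXsubC mul1r.
by rewrite !(hornerXsubC, hornerM, hornerD) /=; ring.
Qed.

(** Newton's identity [e1 ^ 2 - 2 e2 = p2], read off the reversed polynomial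
    [1 - e1 X + e2 X ^ 2 - ...]. *)
Lemma newton_prod_1subX s :
  let P := \prod_(t <- s) (1 - t *: 'X) in
  [/\ P`_0 = 1 & P`_1 ^+ 2 - 2 * P`_0 * P`_2 = \sum_(t <- s) t ^+ 2].
Proof.
elim: s => [|t s [P0 IHs]] /=.
  by rewrite !big_nil !coefE /= expr0n /= mulr0 subr0.
rewrite !big_cons mulrBl mul1r -scalerAl !coefB !coefZ !coefXM /=.
rewrite -IHs P0; split; ring.
Qed.

End RootSeq.

Section RealRooted.
Variable R : rcfType.
Implicit Types (L : {poly R}) (s : seq R) (t : R).
Local Notation C := (complex R).
Local Notation rc := (real_complex R).

(** The zero polynomial is excluded, since every complex number is a root of it. *)
Definition real_rooted L :=
  forall z : C, root (map_poly rc L) z -> complex.Im z = 0.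

Lemma real_rooted_split L : real_rooted L ->
  exists s, L = lead_coef L *: \prod_(t <- s) ('X - t%:P).
Proof.
move=> LR; have [L0|L0] := eqVneq L 0.
  by exists [::]; rewrite L0 lead_coef0 scale0r.
have [r rE] := closed_field_poly_normal (map_poly rc L).
exists (map (@complex.Re R) r).
apply: (map_poly_inj rc); rewrite rE map_polyZ lead_coef_map /=.
congr (_ *: _); rewrite rmorph_prod big_map; apply: eq_big_seq => z zr /=.
rewrite map_polyXsubC; congr (_ - _%:P).
have /LR : root (map_poly rc L) z.
  rewrite rE rootZ ?root_prod_XsubC //.
  by rewrite lead_coef_map fmorph_eq0 lead_coef_eq0.
by case: {zr} z => a b /= ->.
Qed.

Lemma real_rooted_neq0 L : real_rooted L -> L != 0.
Proof.
move=> LR; apply/eqP => L0; have := LR (Complex 0 1).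
rewrite L0 rmorph0 root0 /= => /(_ isT) /eqP.
by rewrite oner_eq0.
Qed.

(** For real [t], [1 / (z - t)] lies in the half-plane opposite to that of [z], and so does a
    nonempty sum of such terms. *)
Lemma Im_sum_inv_sub s (z : C) : s != [::] -> complex.Im z != 0 ->
  complex.Im z * complex.Im (\sum_(t <- s) (z - rc t)^-1) < 0.
Proof.
move=> + z0.
have ImD (x y : C) : complex.Im (x + y) = complex.Im x + complex.Im y.
  by case: x => ? ?; case: y.
have Iminv t : complex.Im z * complex.Im (z - rc t)^-1 < 0.
  case: z z0 => a b /= b0; rewrite oppr0 addr0.
  rewrite mulrN oppr_lt0 mulrA divr_gt0 // ?expr2.
    by rewrite lt_def mulf_neq0 //= -expr2 sqr_ge0.
  rewrite -!expr2; apply: ltr_wpDl; first exact: sqr_ge0.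
  by rewrite lt_def sqrf_eq0 b0 sqr_ge0.
elim: s => // t [|u s] IHs _; first by rewrite big_seq1.
by rewrite big_cons ImD mulrDr -[ltRHS]addr0 ltrD // IHs.
Qed.

(** Off the real axis the combination is [L * (a + b L' / L)], and [L' / L] has nonzero imaginary
    part there. The case [a = 0] is Rolle's theorem; [L - r L'] serves for the concavity of the
    ratio. *)
Lemma real_rooted_comb L a b : real_rooted L -> (1 < size L)%N ->
  (a != 0) || (b != 0) -> real_rooted (a *: L + b *: L^`()).
Proof.
move=> LR sL ab z; rewrite /root; apply: contraTeq => z0.
have Lz : (map_poly rc L).[z] != 0.
  by apply: contraNN z0 => /LR ->.
have [s Ls] := real_rooted_split LR.
have s0 : s != [::].
  apply: contraTN sL => /eqP s0; rewrite Ls s0 big_nil -leqNgt.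
  by rewrite (leq_trans (size_scale_leq _ _)) // size_poly1.
have l0 : lead_coef L != 0 by rewrite lead_coef_eq0 real_rooted_neq0.
set sm := \sum_(t <- s) (z - rc t)^-1.
have dE : (map_poly rc L^`()).[z] = (map_poly rc L).[z] * sm.
  have mE : map_poly rc L =
      rc (lead_coef L) *: \prod_(t <- map rc s) ('X - t%:P).
    rewrite {1}Ls map_polyZ rmorph_prod big_map /=; congr (_ *: _).
    by apply: eq_bigr => t _; rewrite map_polyXsubC.
  rewrite -deriv_map mE derivZ !hornerZ deriv_prod_XsubC ?mulrA.
    by rewrite /sm !big_map.
  by move: Lz; rewrite mE hornerZ mulf_eq0 negb_or => /andP[].
have smI := Im_sum_inv_sub s0 z0.
rewrite rmorphD /= !map_polyZ hornerD !hornerZ dE mulrCA.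
rewrite [rc a * _]mulrC -mulrDr mulf_neq0 //.
rewrite -/sm in smI; case: sm smI {dE} => u v /=.
rewrite eq_complex /= !mul0r subr0 addr0 add0r.
apply: contraTN => /andP[/eqP e1 /eqP e2]; rewrite -leNgt.
have [v0|v0] := eqVneq v 0; first by rewrite v0 mulr0.
have b0 : b = 0.
  by apply/eqP; move/eqP: e2; rewrite mulf_eq0 (negPf v0) orbF.
by move: ab e1; rewrite b0 mul0r addr0 eqxx orbF => /eqP.
Qed.

Lemma real_rooted_deriv L : real_rooted L -> (1 < size L)%N ->
  real_rooted L^`().
Proof.
move=> LR sL; have := @real_rooted_comb L 0 1 LR sL.
by rewrite oner_eq0 orbT scale0r add0r scale1r => /(_ isT).
Qed.

Lemma size_deriv_char0 L : size L^`() = (size L).-1.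
Proof.
have [L0|L0] := eqVneq (size L) 0%N.
  by move/eqP: L0; rewrite size_poly_eq0 => /eqP ->; rewrite deriv0 size_poly0.
have [s1|s1] := leqP (size L) 1.
  by rewrite (size1_polyC s1) derivC size_poly0 size_polyC; case: (_ != _).
apply/eqP; rewrite eqn_leq; apply/andP; split.
  by rewrite -ltnS prednK ?lt_size_deriv // -?size_poly_gt0 ltnW // -ltnS.
case sE: (size L) s1 => [|[|m]] //= _.
rewrite ltnNge; apply/negP => /leq_sizeP /(_ m (leqnn _)) /eqP.
rewrite coef_deriv mulrn_eq0 /= => /eqP Lm.
have : lead_coef L = 0 by rewrite lead_coefE sE.
by move/eqP; rewrite lead_coef_eq0 -size_poly_eq0 sE.
Qed.

Lemma size_derivn_char0 L k : size L^`(k) = (size L - k)%N.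
Proof.
elim: k => [|k IHk]; first by rewrite subn0.
by rewrite derivnS size_deriv_char0 IHk subnS.
Qed.

Lemma real_rooted_derivn L k : real_rooted L -> (k < size L)%N ->
  real_rooted L^`(k).
Proof.
move=> LR; elim: k => // k IHk kL; rewrite derivnS.
apply: real_rooted_deriv; first exact/IHk/ltnW.
by rewrite size_derivn_char0 ltn_subRL addn1.
Qed.

(** A sum of squares by [newton_prod_XsubC]; the one contributed by the first root is positive
    because [t] is no root. *)
Lemma real_rooted_newton L t : real_rooted L -> (1 < size L)%N ->
  L.[t] != 0 -> 0 < L^`().[t] ^+ 2 - L.[t] * L^`()^`().[t].
Proof.
move=> LR sL; have [s Ls] := real_rooted_split LR.
have l0 : lead_coef L != 0 by rewrite lead_coef_eq0 real_rooted_neq0.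
have s0 : s != [::].
  apply: contraTN sL => /eqP s0; rewrite Ls s0 big_nil -leqNgt.
  by rewrite (leq_trans (size_scale_leq _ _)) // size_poly1.
rewrite Ls; set a := lead_coef L; rewrite !derivZ !hornerZ => Lt.
set P := \prod_(t <- s) _.
have -> : (a * P^`().[t]) ^+ 2 - a * P.[t] * (a * P^`()^`().[t]) =
  a ^+ 2 * (P^`().[t] ^+ 2 - P.[t] * P^`()^`().[t]) by ring.
rewrite pmulr_rgt0; last by rewrite lt_def sqr_ge0 sqrf_eq0 l0.
have {Lt} : P.[t] != 0 by apply: contraNN Lt => /eqP ->; rewrite mulr0.
rewrite /P; elim: s s0 {Ls P} => // u s IHs _.
rewrite big_cons newton_prod_XsubC hornerM mulf_eq0 negb_or => /andP[u0 Pt].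
rewrite ltr_pwDl //.
  by rewrite lt_def sqr_ge0 sqrf_eq0 Pt.
rewrite mulr_ge0 ?sqr_ge0 //.
case: s IHs Pt => [|v s] IHs Pt; last by rewrite ltW // IHs.
by rewrite !big_nil -polyC1 !derivC !hornerC expr0n /= mulr0 subr0.
Qed.

Lemma lead_coef_prod_XsubC s a :
  lead_coef (a *: \prod_(t <- s) ('X - t%:P)) = a.
Proof. by rewrite lead_coefZ (monicP (monic_prod_XsubC _ _ _)) mulr1. Qed.

(** Without positive roots every linear factor has nonnegative coefficients. *)
Lemma real_rooted_coef_ge0 L : real_rooted L -> 0 <= lead_coef L ->
  (forall t, 0 < t -> L.[t] != 0) -> forall k, 0 <= L`_k.
Proof.
move=> LR; have [s ->] := real_rooted_split LR.
rewrite lead_coef_prod_XsubC; set a := lead_coef L => a0 Ln0 k.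
rewrite coefZ mulr_ge0 //.
have {Ln0} : forall t, 0 < t -> (\prod_(t <- s) ('X - t%:P)).[t] != 0.
  by move=> t /Ln0; rewrite hornerZ mulf_eq0 negb_or => /andP[].
elim: s k => [|t s IHs] k; first by rewrite big_nil coef1 ler0n.
rewrite big_cons => Ln0; rewrite mulrBl coefB coefXM coefCM.
have Hs j : 0 <= (\prod_(t <- s) ('X - t%:P))`_j.
  apply: IHs => u /Ln0; rewrite hornerM mulf_eq0 negb_or.
  by case/andP.
rewrite subr_ge0 (@le_trans _ _ 0) //; last by case: ifP.
rewrite mulr_le0_ge0 // leNgt; apply/negP => /Ln0.
by rewrite hornerM hornerXsubC subrr mul0r eqxx.
Qed.

Lemma real_rooted_coef_gt0 L : real_rooted L -> 0 < lead_coef L ->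
  (forall t, 0 <= t -> L.[t] != 0) -> forall k, (k < size L)%N -> 0 < L`_k.
Proof.
move=> LR; have [s ->] := real_rooted_split LR.
rewrite lead_coef_prod_XsubC; set a := lead_coef L => a0 Ln0 k.
rewrite size_scale ?gt_eqF // size_prod_XsubC ltnS => ks.
rewrite coefZ mulr_gt0 //.
have {Ln0} : forall t, 0 <= t -> (\prod_(t <- s) ('X - t%:P)).[t] != 0.
  by move=> t /Ln0; rewrite hornerZ mulf_eq0 negb_or => /andP[].
elim: s k ks => [|t s IHs] k /=.
  by rewrite leqn0 => /eqP ->; rewrite big_nil coef1.
rewrite big_cons => ks Ln0; rewrite mulrBl coefB coefXM coefCM.
have Hs j : (j <= size s)%N -> 0 < (\prod_(t <- s) ('X - t%:P))`_j.
  move=> js; apply: IHs => // u /Ln0; rewrite hornerM mulf_eq0 negb_or.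
  by case/andP.
have t0 : t < 0.
  rewrite ltNge; apply/negP => /Ln0.
  by rewrite hornerM hornerXsubC subrr mul0r eqxx.
case: k ks => [|k] ks /=.
  by rewrite sub0r oppr_gt0 nmulr_rlt0 // Hs.
rewrite subr_gt0 (@le_lt_trans _ _ 0) ?Hs //.
rewrite nmulr_rle0 //; case: (ltnP k (size s)) => [/Hs/ltW //|sk].
by rewrite nth_default // size_prod_XsubC.
Qed.

Lemma horner_ge_coef L t k : (forall j, 0 <= L`_j) -> 0 <= t ->
  L`_k * t ^+ k <= L.[t].
Proof.
move=> L0 t0; rewrite (horner_coef_wide t (leq_maxl (size L) k.+1)).
have kl : (k < maxn (size L) k.+1)%N by rewrite leq_maxr.
rewrite (bigD1 (Ordinal kl)) //= lerDl sumr_ge0 // => j _.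
by rewrite mulr_ge0 ?exprn_ge0.
Qed.

(** A positive constant coefficient excludes the root 0. This is what places a point of the closed
    cone with positive value in the open cone. *)
Lemma real_rooted_coef_gt0W L : real_rooted L -> (forall j, 0 <= L`_j) ->
  0 < L`_0 -> forall k, (k < size L)%N -> 0 < L`_k.
Proof.
move=> LR Lge0 L0; apply: real_rooted_coef_gt0 => //.
  by rewrite lt_def lead_coef_eq0 real_rooted_neq0 // lead_coefE Lge0.
move=> t t0; rewrite gt_eqF // (lt_le_trans L0) //.
by have := @horner_ge_coef L t 0 Lge0 t0; rewrite expr0 mulr1.
Qed.

Lemma derivn_coef0 L k : L^`(k).[0] = L`_k *+ k`!.
Proof. by rewrite horner_coef0 coef_derivn addn0 ffactnn. Qed.

Lemma coef_newton L k : real_rooted L -> (k.+1 < size L)%N -> L`_k != 0 ->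
  0 < (L`_k.+1 *+ k.+1`!) ^+ 2 - L`_k *+ k`! * (L`_k.+2 *+ k.+2`!).
Proof.
move=> LR kL Lk; rewrite -!derivn_coef0 !derivnS.
apply: real_rooted_newton.
- by apply: real_rooted_derivn => //; exact: ltnW.
- by rewrite size_derivn_char0 ltn_subRL addn1.
- by rewrite derivn_coef0 mulrn_eq0 negb_or Lk -lt0n fact_gt0.
Qed.

(* Two consecutive zero coefficients below the leading one force all the lower
   ones to vanish, by Newton's inequality. *)
Lemma coef_zeros L k : real_rooted L -> (k.+2 < size L)%N ->
  L`_k = 0 -> L`_k.+1 = 0 -> forall j, (j <= k.+1)%N -> L`_j = 0.
Proof.
move=> LR; elim: k => [|k IHk] kL Lk Lk1 j.
  by case: j => [|[|]].
rewrite leq_eqVlt => /predU1P[-> //|jk]; apply: IHk => //; first exact: ltnW.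
apply/eqP/negPn/negP => /(coef_newton LR (ltnW (ltnW kL))).
by rewrite Lk Lk1 !mul0rn mulr0 expr0n subr0 ltxx.
Qed.

(** The degree is [k + 2], so coefficient [k + 1] gives the sum of the roots and coefficient [k]
    their second elementary symmetric function. When the sum is 0 the latter is at most 0, hence 0
    here, and all roots vanish. *)
Lemma coef_sum0 L k : real_rooted L -> size L = k.+3 -> 0 < lead_coef L ->
  0 <= L`_k -> L`_k.+1 = 0 -> forall j, (j <= k.+1)%N -> L`_j = 0.
Proof.
move=> LR sL lL Lk Lk1; apply: coef_zeros => //; first by rewrite sL.
apply/eqP/negPn/negP => Lk0.
have := @coef_newton L k LR _ Lk0; rewrite sL => /(_ (ltnW (leqnn _))).
rewrite Lk1 mul0rn expr0n sub0r oppr_gt0 ltNge mulr_ge0 //.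
  by rewrite mulrn_wge0.
by rewrite mulrn_wge0 // -[k.+2]/(k.+3.-1) -sL -lead_coefE ltW.
Qed.

End RealRooted.

(** * Continuity of roots *)

(** Connectedness of the half-line: the segments from 0 on which [Q] holds cannot have a finite
    supremum of lengths. *)
Lemma locally_constant (R : realType) (Q : R -> Prop) :
  (forall u, exists2 d, 0 < d & forall v, `|v - u| < d -> (Q v <-> Q u)) ->
  Q 0 -> forall u, 0 <= u -> Q u.
Proof.
move=> Qloc Q0 u u0; apply: contrapT => Qu.
pose S := [set v : R | 0 <= v /\ (forall w, 0 <= w <= v -> Q w)].
have S0 : S 0.
  by split=> // w /andP[w0 w1]; have -> : w = 0 by apply/le_anti; rewrite w0 w1.
have Sub : ubound S u.
  move=> v [v0 Qv]; rewrite leNgt; apply/negP => uv; apply: Qu.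
  by apply: Qv; rewrite u0 ltW.
have hS : has_sup S by split; [exists 0|exists u].
have s0 : 0 <= sup S by apply: sup_upper_bound.
have [d d0 Qd] := Qloc (sup S).
have [v [v0 Qv] vS] := sup_adherent d0 hS.
have vs : v <= sup S by apply: sup_upper_bound.
have Qs : Q (sup S).
  apply/(Qd v); last by apply: Qv; rewrite v0 lexx.
  by rewrite distrC ger0_norm ?subr_ge0 // ltrBlDl -ltrBlDr.
have : S (sup S + d / 2).
  split=> [|w /andP[w0 w1]]; first by rewrite addr_ge0 // divr_ge0 // ltW.
  have [wv|vw] := leP w v; first by apply: Qv; rewrite w0.
  apply/(Qd w) => //; rewrite ltr_norml; apply/andP; split; lra.
move=> /(sup_upper_bound hS); lra.
Qed.

Section ComplexNorm.
Variable R : realType.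
Local Notation C := (complex R).
Local Notation rc := (real_complex R).
Local Notation Re := (@complex.Re R).
Local Notation Im := (@complex.Im R).
Local Notation normc := (@ComplexField.Normc.normc R).
Implicit Types (x y z : C) (s : seq C).

Lemma normc_ge0 z : 0 <= normc z.
Proof. by case: z => a b; exact: sqrtr_ge0. Qed.

Lemma normc_triangle x y : normc (x + y) <= normc x + normc y.
Proof. exact: le_normcD. Qed.

Lemma normc_opp z : normc (- z) = normc z.
Proof. exact: normcN. Qed.

Lemma normc_real (t : R) : normc (rc t) = `|t|.
Proof. by rewrite /= expr0n addr0 sqrtr_sqr. Qed.

Lemma normcX z k : normc (z ^+ k) = normc z ^+ k.
Proof.
elim: k => [|k IHk]; first by rewrite !expr0 ComplexField.Normc.normc1.
by rewrite !exprS ComplexField.Normc.normcM IHk.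
Qed.

Lemma normc_sum (I : Type) (r : seq I) (f : I -> C) :
  normc (\sum_(i <- r) f i) <= \sum_(i <- r) normc (f i).
Proof.
elim: r => [|i r IHr].
  by rewrite !big_nil ComplexField.Normc.normc0.
by rewrite !big_cons (le_trans (normc_triangle _ _)) // lerD2l.
Qed.

Lemma normc_ge_Im z : `|Im z| <= normc z.
Proof.
case: z => a b /=; rewrite -sqrtr_sqr ler_wsqrtr //.
by rewrite lerDr sqr_ge0.
Qed.

Lemma ImB x y : Im (x - y) = Im x - Im y.
Proof. by case: x => ? ?; case: y. Qed.

Lemma normc_prod_ge_Im s z : (forall w, w \in s -> Im w <= 0) -> 0 <= Im z ->
  Im z ^+ size s <= normc (\prod_(w <- s) (z - w)).
Proof.
move=> sI zI; elim: s sI => [|w s IHs] sI.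
  by rewrite big_nil expr0 ComplexField.Normc.normc1.
rewrite big_cons ComplexField.Normc.normcM exprS ler_pM ?exprn_ge0 //.
  rewrite (le_trans _ (normc_ge_Im _)) // ImB ler_normr lerBrDr gerDl.
  by rewrite sI ?mem_head.
by apply: IHs => v vs; rewrite sI // inE vs orbT.
Qed.

(** The growth in [normc z] matters: it dominates a small change of the coefficients for all [z] of
    the closed half-plane at once, however large. *)
Lemma normc_prod_ge s : (forall w, w \in s -> Im w < 0) ->
  exists2 c, 0 < c & forall z, 0 <= Im z ->
    c * (1 + normc z) ^+ size s <= normc (\prod_(w <- s) (z - w)).
Proof.
elim: s => [|w s IHs] sI.
  exists 1 => // z _.
  by rewrite big_nil expr0 mulr1 ComplexField.Normc.normc1.
have [|c c0 cP] := IHs; first by move=> v vs; rewrite sI // inE vs orbT.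
have wI : 0 < - Im w by rewrite oppr_gt0 sI // mem_head.
(* The bound [b (1 + |z|) <= k |z - w|] adds [|z - w| >= |z| - |w|], taken [b] times, to
   [|z - w| >= b], taken [1 + |w|] times. *)
set b := - Im w in wI; pose k := b + 1 + normc w.
have k0 : 0 < k by rewrite /k -addrA ltr_wpDr // addr_ge0 ?normc_ge0.
exists (b / k * c) => [|z zI]; first by rewrite !mulr_gt0 ?invr_gt0.
rewrite big_cons ComplexField.Normc.normcM exprS mulrACA.
have z1 : 0 <= 1 + normc z by rewrite addr_ge0 ?normc_ge0.
apply: ler_pM; rewrite ?mulr_ge0 ?invr_ge0 ?exprn_ge0 ?(ltW wI) ?(ltW k0)
  ?(ltW c0) // ?cP //.
rewrite mulrAC ler_pdivrMr //.
have zw : b <= normc (z - w).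
  rewrite (le_trans _ (normc_ge_Im _)) // ImB ler_normr.
  by rewrite /b lerDr zI.
have zt : normc z <= normc (z - w) + normc w.
  by rewrite -{1}(subrK w z) normc_triangle.
rewrite /k; have := normc_ge0 w; have := normc_ge0 z; nra.
Qed.

(** The sum of the norms of the Taylor coefficients of [g] at [u]: a Lipschitz constant at [u] for
    real increments of size at most 1. *)
Definition lip_const (g : {poly C}) (u : R) : R :=
  \sum_(i < size (g \Po ('X + (rc u)%:P))) normc (g \Po ('X + (rc u)%:P))`_i.

Lemma lip_const_ge0 g u : 0 <= lip_const g u.
Proof. by apply: sumr_ge0 => i _; exact: normc_ge0. Qed.

Lemma lip_constP g u v : `|v - u| <= 1 ->
  normc (g.[rc v] - g.[rc u]) <= `|v - u| * lip_const g u.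
Proof.
set h := v - u => h1; rewrite /lip_const; set g' := g \Po _.
have -> : g.[rc v] = g'.[rc h].
  by rewrite horner_comp hornerD hornerX hornerC -rmorphD /h subrK.
have -> : g.[rc u] = g'`_0.
  by rewrite -horner_coef0 horner_comp hornerD hornerX hornerC add0r.
rewrite horner_coef; case sg: (size g') => [|m].
  rewrite !big_ord0 [g'`_0]nth_default ?sg // subrr.
  by rewrite ComplexField.Normc.normc0 mulr0.
rewrite !big_ord_recl expr0 mulr1 addrAC subrr add0r.
rewrite (le_trans (normc_sum _ _)) // mulrDr.
apply: ler_wpDl; first by rewrite mulr_ge0 ?normc_ge0.
rewrite mulr_sumr ler_sum // => i _.
rewrite ComplexField.Normc.normcM normcX normc_real mulrC ler_wpM2r ?normc_ge0 //.
by rewrite exprS ler_piMr // exprn_ile1.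
Qed.

Lemma horner_near g u e : 0 < e -> exists2 d, 0 < d &
  forall v, `|v - u| < d -> normc (g.[rc v] - g.[rc u]) < e.
Proof.
move=> e0; pose k := lip_const g u + 1.
have k0 : 0 < k by rewrite ltr_wpDl ?lip_const_ge0.
exists (Num.min 1 (e / k)); first by rewrite lt_min ltr01 divr_gt0.
move=> v; rewrite lt_min => /andP[v1 v2].
apply: (le_lt_trans (lip_constP _ (ltW v1))).
move: v2; rewrite ltr_pdivlMr //; apply: le_lt_trans.
by rewrite ler_wpM2l // /k lerDl.
Qed.

Lemma normc_horner_lead (p : {poly C}) n : (size p <= n.+1)%N -> p`_n != 0 ->
  exists s, [/\ size s = n, forall w, w \in s -> root p w &
    forall z, normc p.[z] = normc p`_n * normc (\prod_(w <- s) (z - w))].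
Proof.
move=> sp pn; have sE : size p = n.+1.
  by apply/eqP; rewrite eqn_leq sp ltnNge; apply: contraNN pn => /leq_sizeP ->.
have lE : lead_coef p = p`_n by rewrite lead_coefE sE.
have [s sP] := closed_field_poly_normal p; exists s; split.
- apply/eqP; rewrite -eqSS -sE sP size_scale ?size_prod_XsubC //.
  by rewrite lE.
- by move=> w ws; rewrite sP rootZ ?lE // root_prod_XsubC.
- move=> z; rewrite {1}sP lE hornerZ ComplexField.Normc.normcM horner_prod.
  by congr (_ * normc _); apply: eq_bigr => w _; rewrite hornerXsubC.
Qed.

(* The roots of the member of parameter [u] cannot leave the lower half-plane:
   as [u] varies they depend continuously on [u] and never meet the real axis. *)
Lemma lower_roots (B : {poly {poly C}}) n (a : C) :
  let Bu u := map_poly (horner_eval (rc u)) B in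
  (size B <= n.+1)%N -> B`_n = a%:P -> a != 0 ->
  (forall u s : R, (Bu u).[rc s] != 0) ->
  (forall z, root (Bu 0) z -> Im z < 0) ->
  forall u, 0 <= u -> forall z, root (Bu u) z -> Im z < 0.
Proof.
move=> Bu sB Bn a0 Breal B0.
have Bs u : (size (Bu u) <= n.+1)%N by rewrite (leq_trans (size_poly _ _)).
have Bun u : (Bu u)`_n = a by rewrite coef_map /= /horner_eval Bn hornerC.
have na0 : 0 < normc a.
  rewrite lt_def normc_ge0 andbT.
  by apply: contraNN a0 => /eqP/ComplexField.Normc.eq0_normc ->.
have Brz u z : root (Bu u) z -> Im z = 0 -> False.
  case: z => s t /= + t0; rewrite t0 => /rootP.
  by apply/eqP; exact: Breal.
apply: locally_constant => // u.
have [Lu|Lu] := pselect (forall z, root (Bu u) z -> Im z < 0).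
  have := @normc_horner_lead _ n (Bs u); rewrite Bun => /(_ a0)[s [ss sr sP]].
  have [c c0 cP] := normc_prod_ge (fun w ws => Lu _ (sr w ws)).
  pose K := \sum_(i < n.+1) lip_const B`_i u.
  have K0 : 0 <= K by apply: sumr_ge0 => i _; exact: lip_const_ge0.
  have K1 : 0 < K + 1 by rewrite ltr_wpDl.
  (* So small that the change at [z], at most [|v - u| * K * (1 + |z|) ^ n], stays below the lower
     bound [|a| * c * (1 + |z|) ^ n] of the modulus on the closed upper half-plane. *)
  exists (Num.min 1 (normc a * c / (K + 1))).
    by rewrite lt_min ltr01 divr_gt0 ?mulr_gt0.
  move=> v; rewrite lt_min => /andP[v1 v2]; split=> // _ z.
  apply: contraTT; rewrite -leNgt => zI; apply/rootP => Bvz.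
  have := sP z; rewrite -[in LHS](subr0 _.[z]) -{1}Bvz -normc_opp opprB => Bz.
  have : normc ((Bu v).[z] - (Bu u).[z]) <=
      `|v - u| * K * (1 + normc z) ^+ n.
    rewrite !(horner_coef_wide _ (Bs _)) -sumrB.
    rewrite (le_trans (normc_sum _ _)) // /K mulr_sumr mulr_suml.
    apply: ler_sum => i _; rewrite -mulrBl ComplexField.Normc.normcM.
    rewrite !coef_map /= /horner_eval ler_pM ?normc_ge0 ?lip_constP ?(ltW v1) //.
    rewrite normcX (@le_trans _ _ ((1 + normc z) ^+ i)) //.
      by rewrite lerXn2r ?nnegrE ?addr_ge0 ?normc_ge0 // lerDr.
    by rewrite ler_weXn2l ?lerDl ?normc_ge0 // -ltnS.
  apply/negP; rewrite -ltNge Bz.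
  have := cP z zI; rewrite ss => /(ler_wpM2l (ltW na0)); apply: lt_le_trans.
  rewrite mulrA ltr_pM2r; last by rewrite exprn_gt0 // ltr_wpDr ?normc_ge0.
  move: v2; rewrite ltr_pdivlMr //; apply: le_lt_trans.
  by rewrite ler_wpM2l // lerDl.
have [z zr zI] : exists2 z, root (Bu u) z & 0 < Im z.
  apply: contrapT => nz; apply: Lu => z zr.
  have [//|zI|/(Brz _ _ zr) //] := ltgtP (Im z) 0.
  by case: nz; exists z.
(* A member with all its roots below the axis has modulus at least [e] at [z], so the members near
   parameter [u], small at [z], are not of that kind. *)
pose e := normc a * Im z ^+ n.
have e0 : 0 < e by rewrite mulr_gt0 ?exprn_gt0.
have BE v : (Bu v).[z] = B.[z%:P].[rc v].
  have := horner_map (horner_eval (rc v)) B z%:P.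
  by rewrite /= /horner_eval hornerC.
have [d d0 dP] := horner_near B.[z%:P] u e0.
exists d => // v /dP; rewrite -!BE (rootP zr) subr0 => Bv.
split=> [Lv|//]; exfalso.
have := @normc_horner_lead _ n (Bs v); rewrite Bun => /(_ a0)[s [ss sr sP]].
have := @normc_prod_ge_Im s z (fun w ws => ltW (Lv _ (sr w ws))) (ltW zI).
rewrite ss => /(ler_wpM2l (ltW na0)); rewrite -sP => /(lt_le_trans Bv).
by rewrite ltxx.
Qed.

End ComplexNorm.

(** * Hyperbolic polynomials and Garding's theorem *)

Section Mmap.
Variables (d : nat) (R : comNzRingType).
Implicit Types (P : mpoly d R).

Lemma mmap_morph (S T : comNzRingType) (phi : {rmorphism S -> T})
    (f : {rmorphism R -> S}) (h : 'I_d -> S) P :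
  phi (mmap f h P) = mmap (phi \o f) (phi \o h) P.
Proof.
rewrite /mmap rmorph_sum; apply: eq_bigr => m _.
rewrite rmorphM /mmap1 rmorph_prod; congr (_ * _).
by apply: eq_bigr => j _; rewrite rmorphXn.
Qed.

Lemma eq_mmap (S : comNzRingType) (f g : R -> S) (h k : 'I_d -> S) P :
  f =1 g -> h =1 k -> mmap f h P = mmap g k P.
Proof.
move=> fg hk; apply: eq_bigr => m _; rewrite fg; congr (_ * _).
by apply: eq_bigr => j _; rewrite hk.
Qed.

Lemma coef_top_mul (S : comNzRingType) (p q : {poly S}) a b :
  (size p <= a.+1)%N -> (size q <= b.+1)%N ->
  (size (p * q)%R <= (a + b).+1)%N /\ (p * q)`_(a + b) = p`_a * q`_b.
Proof.
move=> sp sq; split.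
  rewrite (leq_trans (size_polyMleq _ _)) //.
  by have := leq_add sp sq; rewrite addSn addnS; case: (size p + size q)%N.
have la : (a < (a + b).+1)%N by rewrite ltnS leq_addr.
rewrite coefM (bigD1 (Ordinal la)) //= addKn big1 ?addr0 // => i ia.
have [lt_ia|] := ltnP i a.
  by rewrite [q`__]nth_default ?mulr0 // (leq_trans sq) // ltn_subRL ltn_add2r.
rewrite leq_eqVlt => /predU1P[ai|lt_ai].
  by case/eqP: ia; apply: val_inj.
by rewrite [p`__]nth_default ?mul0r // (leq_trans sp).
Qed.

(** Only the terms [e X] contribute in degree [n]. The ring [S] is general so as to cover both real
    coefficients and coefficients that are polynomials in a second parameter. *)
Lemma coef_top_mmap (S : comNzRingType) (f : {rmorphism R -> S})
    (a e : 'I_d -> S) n P : P \is ishomog1 n mdeg ->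
  let B := mmap (polyC \o f) (fun j => (a j)%:P + (e j)%:P * 'X) P in
  (size B <= n.+1)%N /\ B`_n = mmap f e P.
Proof.
move=> /dhomogP Ph B.
have topX k (p : {poly S}) : (size p <= 2)%N ->
    (size (p ^+ k) <= k.+1)%N /\ (p ^+ k)`_k = p`_1 ^+ k.
  move=> sp; elim: k => [|k [IHs IHc]].
    by rewrite expr0 size_poly1 coef1 expr0.
  by have [] := coef_top_mul sp IHs; rewrite add1n -!exprS IHc -exprS.
have top1 m : let q := mmap1 (fun j => (a j)%:P + (e j)%:P * 'X) m in
    (size q <= (mdeg m).+1)%N /\ q`_(mdeg m) = mmap1 e m.
  rewrite /mmap1 mdegE.
  elim/big_rec3: _ => [|j q k p _ [IHs IHc]]; first by rewrite size_poly1 coef1.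
  have sj : (size ((a j)%:P + (e j)%:P * 'X)%R <= 2)%N.
    rewrite (leq_trans (size_polyD _ _)) // geq_max.
    rewrite (leq_trans (size_polyC_leq1 _)) //=.
    rewrite (leq_trans (size_polyMleq _ _)) // size_polyX addn2 ltnS.
    exact: size_polyC_leq1.
  have [s1 c1] := topX (m j) _ sj.
  have [-> ->] := coef_top_mul s1 IHs; split=> //.
  rewrite c1 IHc; congr (_ ^+ _ * _).
  by rewrite coefD coefC coefCM coefX /= mulr1 add0r.
rewrite /B /mmap; split.
  rewrite (leq_trans (size_sum _ _ _)) //; apply/bigmax_leqP_seq => m mP _.
  have [sm _] := top1 m; rewrite (Ph _ mP) in sm.
  by rewrite mul_polyC (leq_trans (size_scale_leq _ _)).
rewrite coef_sum; apply: eq_big_seq => m mP.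
have [_] := top1 m; rewrite (Ph _ mP) /= => qE.
by rewrite coefCM qE.
Qed.

Lemma mmap_homog (S : comNzRingType) (f : {rmorphism R -> S})
    (h : 'I_d -> S) (l : S) n P : P \is ishomog1 n mdeg ->
  mmap f (fun j => l * h j) P = l ^+ n * mmap f h P.
Proof.
move=> /dhomogP Ph; rewrite /mmap mulr_sumr; apply: eq_big_seq => m mP.
rewrite mulrCA; congr (_ * _); rewrite -(Ph _ mP) /= mdegE /mmap1.
rewrite -prodrXr -big_split /=.
by apply: eq_bigr => j _; rewrite exprMn.
Qed.

End Mmap.

Section Lines.
Variables (R : realType) (d : nat).
Implicit Types (P : mpoly d R) (x y v e : 'rV[R]_d) (t : R).
Local Notation C := (complex R).
Local Notation rc := (real_complex R).
Local Notation Im := (@complex.Im R).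

(** The restriction of [P] to a line, [P (x + X v)], as a polynomial in one variable. *)
Definition lin P x v : {poly R} :=
  mmap polyC (fun j => (x ord0 j)%:P + (v ord0 j)%:P * 'X) P.

Lemma polyfunE P x : polyfun P x = mmap idfun (fun j => x ord0 j) P.
Proof. by []. Qed.

Lemma horner_lin P x v t : (lin P x v).[t] = polyfun P (x + t *: v).
Proof.
rewrite -[LHS]/(horner_eval t _) /lin.
rewrite (@mmap_morph d R {poly R} R (horner_eval t) polyC).
apply: eq_mmap => [a|j] /=; rewrite /horner_eval ?hornerC //.
by rewrite hornerD hornerM !hornerC hornerX !mxE mulrC.
Qed.

Lemma horner_lin_complex P x v (z : C) : (map_poly rc (lin P x v)).[z] =
  mmap rc (fun j => rc (x ord0 j) + z * rc (v ord0 j)) P.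
Proof.
rewrite -[LHS]/((horner_eval z \o map_poly rc) _) /lin.
rewrite (@mmap_morph d R {poly R} C (horner_eval z \o map_poly rc) polyC).
apply: eq_mmap => [a|j] /=; rewrite /horner_eval ?map_polyC ?hornerC //=.
rewrite rmorphD rmorphM /= !map_polyC map_polyX.
by rewrite hornerD hornerM !hornerC hornerX mulrC.
Qed.

Lemma polyfunZ P n x t : homogeneous n P ->
  polyfun P (t *: x) = t ^+ n * polyfun P x.
Proof.
move=> Ph; rewrite !polyfunE -(mmap_homog idfun _ _ Ph).
by apply: eq_mmap => // j; rewrite mxE.
Qed.

Lemma size_lin_leq P n x v : homogeneous n P -> (size (lin P x v) <= n.+1)%N.
Proof.
move=> Ph.
by have [] := coef_top_mmap idfun (fun j => x ord0 j) (fun j => v ord0 j) Ph.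
Qed.

Lemma coef_lin P n x v : homogeneous n P -> (lin P x v)`_n = polyfun P v.
Proof.
move=> Ph.
by have [] := coef_top_mmap idfun (fun j => x ord0 j) (fun j => v ord0 j) Ph.
Qed.

Lemma size_lin P n x v : homogeneous n P -> polyfun P v != 0 ->
  size (lin P x v) = n.+1.
Proof.
move=> Ph Pv; apply/eqP; rewrite eqn_leq size_lin_leq // ltnNge.
apply: contraNN Pv => /leq_sizeP /(_ n (leqnn _)).
by rewrite (coef_lin _ _ Ph) => ->.
Qed.

Lemma lead_coef_lin P n x v : homogeneous n P -> polyfun P v != 0 ->
  lead_coef (lin P x v) = polyfun P v.
Proof. by move=> Ph Pv; rewrite lead_coefE (size_lin _ Ph Pv) (coef_lin _ _ Ph). Qed.

Lemma hyperbolicE P e :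
  hyperbolic P e <-> 0 < polyfun P e /\ forall x, real_rooted (lin P x e).
Proof.
split=> -[Pe H]; split=> // x z.
  by move=> /rootP zr; apply: (H x); rewrite -horner_lin_complex.
by rewrite -horner_lin_complex => zr; apply: (H x); exact/rootP.
Qed.

(* The open hyperbolicity cone, written without connected components. *)
Definition ocone P e : set 'rV[R]_d :=
  [set x | forall t, 0 <= t -> 0 < polyfun P (x + t *: e)].

(* The closed hyperbolicity cone: a real-rooted polynomial with positive leading
   coefficient has no positive root iff its coefficients are nonnegative. *)
Definition ccone P e : set 'rV[R]_d :=
  [set x | forall k, 0 <= (lin P x e)`_k].

(* For real [r], the roots [s] of [P (i e + r x + s y)] lie in the lower
   half-plane: this is clear at [r = 0], and none can become real since [i] is
   not a root of [t |-> P (r x + s y + t e)]. Rescaling, the roots of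
   [P (x + i t e + s y)] lie there for all [t > 0]; let [t] tend to 0. *)
Theorem garding_direction P n e y : homogeneous n P -> hyperbolic P e ->
  ocone P e y -> hyperbolic P y.
Proof.
move=> Ph /hyperbolicE[Pe Pr] Cy.
have Py : 0 < polyfun P y by have := Cy 0 (lexx _); rewrite scale0r addr0.
apply/hyperbolicE; split=> // x.
pose ii : C := Complex 0 1.
pose f : {rmorphism R -> {poly C}} := polyC \o rc.
pose a j : {poly C} := (ii * rc (e ord0 j))%:P + (rc (x ord0 j))%:P * 'X.
pose b j : {poly C} := (rc (y ord0 j))%:P.
(* This is [P (i e + u x + s y)] with outer variable [s] and inner variable [u]; its leading
   coefficient [P y] does not depend on [u]. *)
pose B := mmap (polyC \o f) (fun j => (a j)%:P + (b j)%:P * 'X) P.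
pose ev (s : C) (u : R) := mmap rc
  (fun j => ii * rc (e ord0 j) + rc u * rc (x ord0 j) + s * rc (y ord0 j)) P.
have BE u z : (map_poly (horner_eval (rc u)) B).[z] = ev z u.
  rewrite -[LHS]/((horner_eval z \o map_poly (horner_eval (rc u))) _) /B.
  rewrite (@mmap_morph d R {poly {poly C}} C).
  apply: eq_mmap => [w|j];
    rewrite -[LHS]/((map_poly (horner_eval (rc u)) _).[z]).
    by rewrite map_polyC /= /horner_eval !hornerC.
  rewrite rmorphD rmorphM /= !map_polyC map_polyX !hornerD hornerM !hornerC /=.
  rewrite /b /a /= /horner_eval !(hornerC, hornerD, hornerM, hornerX).
  by rewrite [_ * z]mulrC [_ * rc u]mulrC.
have [sB Bn] := coef_top_mmap f a b Ph.
have {}Bn : B`_n = (rc (polyfun P y))%:P.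
  rewrite Bn polyfunE -[RHS]/((polyC \o rc) _).
  rewrite (@mmap_morph d R R {poly C} (polyC \o rc) idfun).
  exact: eq_mmap.
have Py0 : rc (polyfun P y) != 0 by rewrite fmorph_eq0 gt_eqF.
have low u : 0 <= u -> forall z, ev z u = 0 -> Im z < 0.
  move=> u0 z; rewrite -BE => /rootP; move: u u0 z.
  apply: (lower_roots sB Bn Py0) => [u s|z].
    rewrite BE; apply/eqP => ev0.
    have : root (map_poly rc (lin P (u *: x + s *: y) e)) ii.
      apply/rootP; rewrite horner_lin_complex -ev0; apply: eq_mmap => // j.
      by rewrite !mxE !rmorphD !rmorphM addrC addrA.
    by move/Pr/eqP; rewrite oner_eq0.
  move/rootP; rewrite BE => ev0.
  have z0 : z != 0.
    apply/eqP => z0; suff : ii ^+ n * rc (polyfun P e) = 0.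
      apply/eqP/mulf_neq0; last by rewrite fmorph_eq0 gt_eqF.
      by rewrite expf_neq0 // eq_complex /= oner_eq0 andbF.
    rewrite -ev0 z0 polyfunE.
    rewrite (@mmap_morph d R R C rc idfun) -mmap_homog //.
    by apply: eq_mmap => // j /=; rewrite rmorph0 !mul0r !addr0.
  (* By homogeneity [i / z] is a root of [t |-> P (y + t e)], hence real, and negative because [y]
     is in the cone; so [z] is a negative multiple of [i]. *)
  have tr : root (map_poly rc (lin P y e)) (ii / z).
    apply/rootP; rewrite horner_lin_complex.
    apply: (mulfI (expf_neq0 n z0)); rewrite mulr0 -mmap_homog // -[RHS]ev0.
    apply: eq_mmap => // j /=.
    by rewrite rmorph0 mul0r addr0 mulrDr !mulrA [z * ii]mulrC mulfK // addrC.
  have := Pr _ _ tr; move: tr; set w := ii / z.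
  case wE : w => [t t'] /= + t0; rewrite {}t0 in wE *.
  rewrite -[Complex t 0]/(rc t) (fmorph_root rc) => tr.
  have t0 : t < 0.
    rewrite ltNge; apply/negP => /Cy; rewrite -horner_lin (rootP tr).
    by rewrite ltxx.
  have -> : z = ii * rc t^-1.
    rewrite fmorphV; apply: (mulIf (_ : rc t != 0)).
      by rewrite fmorph_eq0 lt_eqF.
    rewrite mulfVK ?fmorph_eq0 ?lt_eqF // -[rc t]wE /w mulrC divfK //.
  by rewrite /= mul1r mul0r add0r invr_lt0.
have upper z : 0 < Im z -> ~ root (map_poly rc (lin P x y)) z.
  move=> zI /rootP; rewrite horner_lin_complex => Pz0.
  pose g := mmap f (fun j => (rc (x ord0 j) + z * rc (y ord0 j))%:P
     + (ii * rc (e ord0 j))%:P * 'X) P.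
  have gE (t : C) : g.[t] = mmap rc (fun j =>
      rc (x ord0 j) + z * rc (y ord0 j) + t * (ii * rc (e ord0 j))) P.
    rewrite -[LHS]/(horner_eval t _) /g (@mmap_morph d R {poly C} C).
    apply: eq_mmap => [w|j] /=; rewrite /horner_eval ?hornerC //.
    by rewrite !(hornerD, hornerM, hornerC, hornerX) [_ * t]mulrC.
  have g0 : g.[rc 0] = 0.
    by rewrite gE -Pz0; apply: eq_mmap => // j; rewrite rmorph0 mul0r addr0.
  (* By homogeneity [g t] is [t ^ n] times the value at [z / t] of the member of parameter [1 / t],
     whose roots lie below the axis; so [|g t| >= c] for all [t > 0], against [g 0 = 0]. *)
  pose c := polyfun P y * Im z ^+ n.
  have c0 : 0 < c by rewrite mulr_gt0 ?exprn_gt0.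
  have [t0 t00 gt] := horner_near g 0 c0.
  pose t := t0 / 2; have t1 : 0 < t by rewrite divr_gt0.
  have tt0 : t < t0 by rewrite /t; lra.
  have := gt t; rewrite g0 !subr0 gtr0_norm // => /(_ tt0).
  apply/negP; rewrite -leNgt.
  have gz : g.[rc t] = rc t ^+ n * ev (z / rc t) t^-1.
    have tn : rc t != 0 by rewrite fmorph_eq0 gt_eqF.
    rewrite gE /ev -mmap_homog //; apply: eq_mmap => // j.
    by rewrite fmorphV; field.
  have [|s [ss sr sP]] := @normc_horner_lead R
      (map_poly (horner_eval (rc t^-1)) B) n (leq_trans (size_poly _ _) sB).
    by rewrite coef_map /= /horner_eval Bn hornerC.
  have zt : 0 <= Im (z / rc t).
    rewrite -fmorphV; case: (z) zI => p q /= q0.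
    by rewrite mulr0 add0r mulr_ge0 ?invr_ge0 // ltW.
  rewrite gz ComplexField.Normc.normcM normcX -BE sP.
  have := @normc_prod_ge_Im R s (z / rc t) _ zt; rewrite ss => szt.
  rewrite coef_map /= /horner_eval Bn hornerC -/(rc _) normc_real mulrCA.
  rewrite gtr0_norm // /c ler_wpM2l ?(ltW Py) //.
  rewrite -[Num.sqrt _]/(ComplexField.Normc.normc (rc t)) normc_real gtr0_norm //.
  apply: le_trans (ler_wpM2l _ (szt _)); last first.
  - move=> w /sr /rootP; rewrite BE => /low /ltW -> //.
    by rewrite invr_ge0 ltW.
  - by rewrite exprn_ge0 // ltW.
  rewrite -exprMn; apply: lerXn2r; rewrite ?nnegrE ?(ltW zI) //.
    exact: mulr_ge0 (ltW t1) zt.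
  rewrite -fmorphV; case: (z) => p q /=.
  by rewrite mulr0 add0r mulrC mulfVK // gt_eqF.
move=> z zr; have [zI|zI|//] := ltgtP (Im z) 0; last by case: (upper z).
exfalso; apply: (upper (conjc z)).
  by case: z zI {zr} => p q /=; rewrite oppr_gt0.
have -> : map_poly rc (lin P x y) = map_poly conjc (map_poly rc (lin P x y)).
  by rewrite -map_poly_comp; apply: eq_map_poly => w /=; rewrite oppr0.
by rewrite fmorph_root.
Qed.

End Lines.

(** * Directional derivatives *)

(** The chain rule: both sides are derivations that agree on constants and variables. *)
Lemma deriv_mmap (d : nat) (R S : comNzRingType) (f : {rmorphism R -> S})
    (h : 'I_d -> {poly S}) (P : mpoly d R) :
  (mmap (polyC \o f) h P)^`() =
  \sum_j mmap (polyC \o f) h (mderiv j P) * (h j)^`().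
Proof.
pose ev : mpoly d R -> {poly S} := mmap (polyC \o f) h.
pose D P := \sum_j ev (mderiv j P) * (h j)^`().
pose K P := (ev P)^`() = D P.
rewrite -[LHS]/(ev P)^`() -[RHS]/(D P) -/(K P).
have evM : {morph ev : p q / p * q} by exact: rmorphM.
have evD : {morph ev : p q / p + q} by exact: rmorphD.
have DM P1 P2 : D (P1 * P2) = D P1 * ev P2 + ev P1 * D P2.
  rewrite /D mulr_suml mulr_sumr -big_split; apply: eq_bigr => j _ /=.
  by rewrite mderivM evD !evM; ring.
have DD P1 P2 : D (P1 + P2) = D P1 + D P2.
  rewrite /D -big_split; apply: eq_bigr => j _ /=.
  by rewrite mderivD evD mulrDl.
have KM P1 P2 : K P1 -> K P2 -> K (P1 * P2).
  by rewrite /K DM evM derivM => -> ->.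
have KC c : K (mpolyC d c).
  rewrite /K /ev mmapC derivC /D big1 // => j _.
  by rewrite mderivC /ev rmorph0 mul0r.
have K0 : K 0 by have := KC 0; rewrite mpolyC0.
have K1 : K 1 by have := KC 1; rewrite mpolyC1.
have KX j : K (mpolyX R (mnm1 j)).
  rewrite /K /D {1}/ev mmapX mmap1U (bigD1 j) //= mderivX big1 => [|k kj].
    rewrite mnm1E eqxx scale1r addr0.
    have -> : mnm_sub (mnm1 j) (mnm1 j) = mnm0 :> multinom d.
      by apply/mnmP => i; rewrite mnmBE subnn mnm0E.
    by rewrite mpolyX0 /ev rmorph1 mul1r.
  by rewrite mderivX mnm1E eq_sym (negPf kj) scale0r /ev rmorph0 mul0r.
have KXm m : K (mpolyX R m).
  rewrite mpolyXE_id; elim/big_ind: _ => // j _.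
  by elim: (m j) => [|k IHk]; rewrite ?expr0 // exprS; exact: KM.
elim/mpolyind: P => [//|c m P _ _ KP].
rewrite /K evD derivD DD KP -mul_mpolyC; congr (_ + _); exact: KM.
Qed.

Lemma mderiv_homog (d : nat) (R : comNzRingType) n (P : mpoly d R) j :
  P \is ishomog1 n mdeg -> mderiv j P \is ishomog1 n.-1 mdeg.
Proof.
move=> /dhomogP Ph; apply/dhomogP => m /=.
rewrite mcoeff_msupp mcoeff_mderiv => mP.
have : mnm_add m (mnm1 j) \in msupp P.
  by rewrite mcoeff_msupp; apply: contraNN mP => /eqP ->; rewrite mul0rn.
by move=> /Ph /=; rewrite mdegD mdeg1 addn1 => <-.
Qed.

Section DirDeriv.
Variables (R : realType) (d : nat).
Implicit Types (P : mpoly d R) (x y v e : 'rV[R]_d) (t : R).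

Definition dd v P : mpoly d R := \sum_j v ord0 j *: mderiv j P.

Lemma dd_homog n v P : homogeneous n P -> homogeneous n.-1 (dd v P).
Proof.
move=> Ph; rewrite /homogeneous /dd.
by apply: rpred_sum => j _; apply/rpredZ/mderiv_homog.
Qed.

Lemma iter_dd_homog n k v P : homogeneous n P ->
  homogeneous (n - k) (iter k (dd v) P).
Proof.
elim: k => [|k IHk] Ph; first by rewrite subn0.
by rewrite subnS; apply/dd_homog/IHk.
Qed.

Lemma lin_dd v P x : lin (dd v P) x v = (lin P x v)^`().
Proof.
rewrite [in RHS]/lin.
have := @deriv_mmap d R R idfun (fun j => (x ord0 j)%:P + (v ord0 j)%:P * 'X) P.
rewrite -[polyC \o idfun]/(@polyC R) => ->.
rewrite /lin /dd rmorph_sum; apply: eq_bigr => j _.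
by rewrite /= mmapZ derivD derivC add0r derivM derivC derivX mul0r add0r mulr1 mulrC.
Qed.

Lemma lin_iter_dd k v P x : lin (iter k (dd v) P) x v = (lin P x v)^`(k).
Proof. by elim: k => // k IHk; rewrite iterS lin_dd IHk derivnS. Qed.

Lemma polyfun_lin0 P x v : polyfun P x = (lin P x v)`_0.
Proof. by rewrite -horner_coef0 horner_lin scale0r addr0. Qed.

Lemma polyfun_dd P x v : polyfun (dd v P) x = (lin P x v)`_1.
Proof. by rewrite (polyfun_lin0 _ _ v) lin_dd coef_deriv mulr1n. Qed.

Lemma polyfun_iter_dd k P x v :
  polyfun (iter k (dd v) P) x = (lin P x v)`_k *+ k`!.
Proof. by rewrite (polyfun_lin0 _ _ v) lin_iter_dd coef_derivn addn0 ffactnn. Qed.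

Lemma polyfun_continuous P : continuous (polyfun P).
Proof.
elim/mpolyind: P => [|c m P _ _ KP] x.
  have -> : polyfun (0 : mpoly d R) = cst 0.
    by apply/funext => y; rewrite /polyfun meval0.
  exact: cst_continuous.
pose M := \prod_j (fun z : 'rV[R]_d => z ord0 j ^+ m j).
have -> : polyfun (c *: mpolyX R m + P) = cst c \* M \+ polyfun P.
  apply/funext => y; rewrite /polyfun mevalD mevalZ mevalX /= /M.
  by rewrite fct_prodE.
apply: (@continuousD _ _ _ (cst c \* M) (polyfun P)); last exact: KP.
apply: (@continuousM _ _ (cst c) M); first exact: cst_continuous.
rewrite /M; elim/big_ind: _ => [|f g fa gb|j _]; first exact: cst_continuous.
- exact: (@continuousM _ _ f g).
- apply: (@continuous_comp _ _ _ (fun y : 'rV[R]_d => y ord0 j)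
    (fun z : R => z ^+ m j)); first exact: coord_continuous.
  exact: exprn_continuous.
Qed.

(** The difference quotient along [v] is that of [lin P x v] at 0. *)
Lemma is_derive_polyfun P x v :
  is_derive x v (polyfun P : _ -> R^o) (polyfun (dd v P) x).
Proof.
have [+ +] := is_derive_poly (lin P x v) 0.
have lE : (fun h : R => h^-1 *: ((horner (lin P x v) \o shift 0) (h *: 1) -
    (lin P x v).[0])) =
  (fun h : R => h^-1 *: (((polyfun P : _ -> R^o) \o shift x) (h *: v) -
    polyfun P x)).
  apply/funext => h /=; rewrite !horner_lin scale0r !addr0 [_ + x]addrC.
  by rewrite [h *: 1]mulr1.
rewrite /derivable /derive lE -lin_dd horner_coef0 -polyfun_lin0.
by move=> cP dP; split.
Qed.

Lemma dirD_polyfun P k e :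
  dirD (polyfun P) k e = polyfun (iter k (dd e) P).
Proof.
elim: k => [//|k IHk]; rewrite /dirD iterS -/(dirD _ k e) IHk iterS.
apply/funext => x.
exact: (@derive_val _ _ _ _ _ _ _ (is_derive_polyfun (iter k (dd e) P) x e)).
Qed.

End DirDeriv.

(** * Hyperbolicity cones *)

Section Cones.
Variables (R : realType) (d n : nat) (P : mpoly d R) (e : 'rV[R]_d).
Hypotheses (Ph : homogeneous n P) (Pe : hyperbolic P e).
Implicit Types (x y z v : 'rV[R]_d) (t a : R).

Lemma hyperbolic_gt0 : 0 < polyfun P e.
Proof. by case: Pe. Qed.

Lemma lin_real_rooted x : real_rooted (lin P x e).
Proof. by have /hyperbolicE[] := Pe. Qed.

Lemma size_lin_hyp x : size (lin P x e) = n.+1.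
Proof. by rewrite (size_lin x Ph) // gt_eqF // hyperbolic_gt0. Qed.

Lemma lead_coef_lin_gt0 x : 0 < lead_coef (lin P x e).
Proof. by rewrite (lead_coef_lin x Ph) ?gt_eqF // hyperbolic_gt0. Qed.

Lemma coef_lin_gt x k : (n < k)%N -> (lin P x e)`_k = 0.
Proof. by move=> nk; rewrite nth_default // size_lin_hyp. Qed.

(** Without roots [t >= 0] every linear factor has positive coefficients; conversely the constant
    coefficient bounds the values at [t >= 0] from below. *)
Lemma oconeP x :
  ocone P e x <-> forall k, (k <= n)%N -> 0 < (lin P x e)`_k.
Proof.
split=> [Cx k kn|Cx t t0].
  apply: real_rooted_coef_gt0 => [|||]; rewrite ?size_lin_hyp //.
  - exact: lin_real_rooted.
  - exact: lead_coef_lin_gt0.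
  - by move=> t t0; rewrite horner_lin gt_eqF // Cx.
rewrite -horner_lin; apply: (lt_le_trans (Cx 0%N (leq0n _))).
rewrite -[leLHS]mulr1 -(expr0 t); apply: horner_ge_coef => // k.
by have [/Cx/ltW //|/(coef_lin_gt x) ->] := leqP k n.
Qed.

Lemma cconeP x : ccone P e x <-> forall t, 0 < t -> 0 < polyfun P (x + t *: e).
Proof.
split=> [Cx t t0|Cx].
  rewrite -horner_lin; have := horner_ge_coef n Cx (ltW t0).
  apply: lt_le_trans; rewrite (coef_lin _ _ Ph).
  by rewrite mulr_gt0 ?exprn_gt0 ?hyperbolic_gt0.
apply: real_rooted_coef_ge0; first exact: lin_real_rooted.
  exact: ltW (lead_coef_lin_gt0 x).
by move=> t t0; rewrite horner_lin gt_eqF // Cx.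
Qed.

Lemma ccone_ocone x t : ccone P e x -> 0 < t -> ocone P e (x + t *: e).
Proof.
move=> /cconeP Cx t0 s s0.
by rewrite -addrA -scalerDl Cx // ltr_wpDr.
Qed.

Lemma ocone_ccone x : ocone P e x -> ccone P e x.
Proof. by move=> Cx; apply/cconeP => t t0; apply: Cx; exact: ltW. Qed.

Lemma ocone_gt0 x : ocone P e x -> 0 < polyfun P x.
Proof. by move=> /(_ 0 (lexx _)); rewrite scale0r addr0. Qed.

Lemma ccone_gt0_ocone x : ccone P e x -> 0 < polyfun P x -> ocone P e x.
Proof.
move=> Cx; rewrite (polyfun_lin0 _ _ e) => Px; apply/oconeP => k kn.
apply: real_rooted_coef_gt0W => //; first exact: lin_real_rooted.
by rewrite size_lin_hyp.
Qed.

Lemma ocone_dir : ocone P e e.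
Proof.
move=> t t0; rewrite -{1}[e]scale1r -scalerDl (polyfunZ _ _ Ph).
by rewrite mulr_gt0 ?exprn_gt0 ?hyperbolic_gt0 // ltr_pwDl.
Qed.

Lemma polyfun_scale_dir x t a : a != 0 ->
  polyfun P (a *: x + t *: e) = a ^+ n * polyfun P (x + (t / a) *: e).
Proof.
move=> a0; rewrite -(polyfunZ _ _ Ph) scalerDr scalerA mulrC.
by rewrite divfK.
Qed.

Lemma ocone_scale x a : 0 < a -> ocone P e x -> ocone P e (a *: x).
Proof.
move=> a0 Cx t t0; rewrite polyfun_scale_dir ?gt_eqF //.
by rewrite mulr_gt0 ?exprn_gt0 // Cx // divr_ge0 // ltW.
Qed.

Lemma ccone0 : ccone P e 0.
Proof.
apply/cconeP => t t0; rewrite add0r (polyfunZ _ _ Ph).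
by rewrite mulr_gt0 ?exprn_gt0 ?hyperbolic_gt0.
Qed.

Lemma ccone_scale x a : 0 <= a -> ccone P e x -> ccone P e (a *: x).
Proof.
rewrite le_eqVlt => /predU1P[<- _|a0 /cconeP Cx].
  by rewrite scale0r; exact: ccone0.
apply/cconeP => t t0; rewrite polyfun_scale_dir ?gt_eqF //.
by rewrite mulr_gt0 ?exprn_gt0 // Cx // divr_gt0.
Qed.

Lemma lin_coef_continuous k : continuous (fun x => (lin P x e)`_k).
Proof.
move=> x; have -> : (fun x => (lin P x e)`_k) =
    (fun x => (k`!%:R)^-1 * polyfun (iter k (dd e) P) x).
  apply/funext => y; rewrite (polyfun_iter_dd _ _ _ e).
  rewrite -(mulr_natr (lin P y e)`_k) mulrCA.
  by rewrite mulVf ?mulr1 // pnatr_eq0 -lt0n fact_gt0.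
apply: (@continuousM _ _ (cst _) (polyfun _)); first exact: cst_continuous.
exact: polyfun_continuous.
Qed.

Lemma ocone_open : open (ocone P e).
Proof.
have -> : ocone P e = [set x | forall k : 'I_n.+1, 0 < (lin P x e)`_k].
  apply/seteqP; split=> x.
    by move=> /oconeP Cx k; apply: Cx; rewrite -ltnS.
  by move=> Cx; apply/oconeP => k kn; apply: (Cx (Ordinal (kn : (k < n.+1)%N))).
rewrite openE => x Cx.
suff : \forall y \near x, forall k : 'I_n.+1, 0 < (lin P y e)`_k by [].
pose pos (k : 'I_n.+1) y := is_true (0 < (lin P y e)`_k).
apply: (@filter_forall _ _ pos (nbhs x) (nbhs_filter x)) => k; rewrite /pos.
have : nbhs (lin P x e)`_k [set u : R | u > 0].
  by apply: open_nbhs_nbhs; split; [exact: open_gt|exact: Cx].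
exact: (lin_coef_continuous (k := k)).
Qed.

Lemma ccone_closed : closed (ccone P e).
Proof.
have -> : ccone P e = \bigcap_k [set x | 0 <= (lin P x e)`_k].
  by apply/seteqP; split=> x Cx k; [move=> _|]; apply: Cx.
apply: closed_bigI => k _.
have := @closed_ge R 0.
by apply: closed_comp => x _; exact: lin_coef_continuous.
Qed.

(** Within the component [ocone] is open, and closed because it is the trace of [ccone] there.
    Conversely the segment from a point of [ocone] to [e] stays in the set where [P] is positive. *)
Lemma open_coneE : open_cone (polyfun P) e = ocone P e.
Proof.
rewrite /open_cone; set U := [set x | _].
have Ue : U e by exact: hyperbolic_gt0.
have Ce := ocone_dir.
apply/seteqP; split=> [|x Cx].
  set K := connected_component U e.
  suff <- : K `&` ocone P e = K by move=> x [].
  apply: (@component_connected _ U e).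
  - by exists e; split=> //; exact: connected_component_refl.
  - by exists (ocone P e) => //; exact: ocone_open.
  - exists (ccone P e); first exact: ccone_closed.
    apply/seteqP; split=> x [Kx Cx]; split=> //; first exact: ocone_ccone.
    by apply: ccone_gt0_ocone => //; exact: (connected_component_sub Kx).
pose f (u : R) := x + u *: (e - x).
apply: (@connected_component_max _ U (f @` `[0, 1])).
- exists 1; last by rewrite /f scale1r addrC subrK.
  by rewrite /= in_itv /= ler01 lexx.
- move=> _ [u + <-]; rewrite /= in_itv /= => /andP[u0 u1].
  have -> : f u = (1 - u) *: x + u *: e.
    by rewrite /f scalerBr scalerBl scale1r addrAC addrA.
  have [->|u1'] := eqVneq u 1.
    by rewrite subrr scale0r add0r scale1r.
  rewrite /U /= polyfun_scale_dir ?subr_eq0 1?eq_sym //.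
  have v0 : 0 < 1 - u by rewrite subr_gt0 lt_def eq_sym u1'.
  by rewrite mulr_gt0 ?exprn_gt0 // Cx // divr_ge0 // ltW.
- apply: connected_continuous_connected; first exact: segment_connected.
  apply: continuous_subspaceT => u; apply: cvgD; first exact: cvg_cst.
  exact: scalel_continuous.
- exists 0; last by rewrite /f scale0r addr0.
  by rewrite /= in_itv /= ler01 lexx.
Qed.

Lemma closed_coneE : closed_cone (polyfun P) e = ccone P e.
Proof.
rewrite /closed_cone open_coneE; apply/seteqP; split=> [|x Cx].
  rewrite ((closure_id (ccone P e)).1 ccone_closed).
  by apply: closureS => x; exact: ocone_ccone.
move=> B xB.
have : (fun t => x + t *: e) @ 0 --> x + 0 *: e.
  by apply: cvgD; [exact: cvg_cst|exact: scalel_continuous].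
rewrite scale0r addr0 => /(_ _ xB) /nbhs_ballP[t /= t0 tB].
exists (x + (t / 2) *: e); split; first by apply: ccone_ocone; rewrite ?divr_gt0.
apply: tB; rewrite /ball /= sub0r normrN gtr0_norm ?divr_gt0 //; lra.
Qed.

End Cones.

(** * Change of direction and convexity of the cones *)

Section ConeConvexity.
Variables (R : realType) (d n : nat) (P : mpoly d R) (e : 'rV[R]_d).
Hypotheses (Ph : homogeneous n P) (Pe : hyperbolic P e).
Implicit Types (x y z v : 'rV[R]_d) (t a : R).

(** [y] is itself a direction of hyperbolicity, and the components through [y] and [e] coincide. *)
Lemma ocone_change_dir y : ocone P e y -> ocone P y = ocone P e.
Proof.
move=> Cy; have Py := garding_direction Ph Pe Cy.
rewrite -(open_coneE Ph Py) -(open_coneE Ph Pe).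
by apply/esym/same_connected_component; rewrite -/(open_cone _ _) (open_coneE Ph Pe).
Qed.

(** With [y] as the direction, the sum is [z] moved one unit along it. *)
Lemma ocone_add y z : ocone P e y -> ocone P e z -> ocone P e (y + z).
Proof.
move=> Cy; rewrite -(ocone_change_dir Cy) addrC => Cz t t0.
by rewrite -addrA -{1}[y]scale1r -scalerDl Cz // addr_ge0.
Qed.

Lemma ccone_add y z : ccone P e y -> ccone P e z -> ccone P e (y + z).
Proof.
move=> Cy Cz; apply/(cconeP Ph Pe) => t t0.
have t2 : 0 < t / 2 by rewrite divr_gt0.
have := ocone_add (ccone_ocone Ph Pe Cy t2) (ccone_ocone Ph Pe Cz t2).
by rewrite addrACA -scalerDl -splitr => /ocone_gt0.
Qed.

End ConeConvexity.

(** * Cones of the iterated derivatives *)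

Section Derivatives.
Variables (R : realType) (d n : nat) (P : mpoly d R) (e : 'rV[R]_d).
Hypotheses (Ph : homogeneous n P) (Pe : hyperbolic P e).
Variables (i : nat).
Hypothesis le_in : (i <= n)%N.
Implicit Types (x y z v : 'rV[R]_d) (t a : R).
Let q := iter i (dd e) P.

Lemma coef_lin_iter_dd x k :
  (lin q x e)`_k = (lin P x e)`_(i + k) *+ ((i + k) ^_ i).
Proof. by rewrite /q lin_iter_dd coef_derivn. Qed.

Lemma hyperbolic_iter_dd : hyperbolic q e.
Proof.
apply/hyperbolicE; split.
  rewrite /q (polyfun_iter_dd _ _ _ e) pmulrn_lgt0 ?fact_gt0 //.
  by apply: (oconeP Ph Pe e).1 => //; exact: ocone_dir Ph Pe.
move=> x; rewrite /q lin_iter_dd; apply: real_rooted_derivn.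
  exact: lin_real_rooted.
by rewrite (size_lin_hyp Ph Pe).
Qed.

Lemma ocone_iter_ddP x : ocone q e x <->
  forall k, (i <= k <= n)%N -> 0 < (lin P x e)`_k.
Proof.
split=> [/(oconeP (iter_dd_homog i e Ph) hyperbolic_iter_dd) Cx k|Cx].
  case/andP=> ik kn; have := Cx (k - i)%N; rewrite leq_sub2r // => /(_ isT).
  by rewrite coef_lin_iter_dd subnKC // pmulrn_lgt0 // ffact_gt0.
apply/(oconeP (iter_dd_homog i e Ph) hyperbolic_iter_dd) => k kn.
rewrite coef_lin_iter_dd pmulrn_lgt0 ?ffact_gt0 ?leq_addr // Cx //.
by rewrite leq_addr -leq_subRL.
Qed.

Lemma ccone_iter_ddP x : ccone q e x <->
  forall k, (i <= k)%N -> 0 <= (lin P x e)`_k.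
Proof.
split=> Cx k.
  move=> ik; have := Cx (k - i)%N.
  by rewrite coef_lin_iter_dd subnKC // pmulrn_lge0 // ffact_gt0.
by rewrite coef_lin_iter_dd mulrn_wge0 // Cx // leq_addr.
Qed.

End Derivatives.

(** * Concavity of the ratio of a polynomial to its derivative *)

Section Widen.
Variables (R : comNzRingType) (d : nat).
Implicit Types P : mpoly d R.

Definition widen1 P : mpoly (d + 1) R :=
  mmap (@mpolyC (d + 1) R) (fun j => mpolyX R (mnm1 (lshift 1 j))) P.

Lemma mmap_widen1 (S : comNzRingType) (f : {rmorphism R -> S})
    (h : 'I_(d + 1) -> S) P :
  mmap f h (widen1 P) = mmap f (fun j => h (lshift 1 j)) P.
Proof.
rewrite /widen1 (@mmap_morph _ _ _ _ (mmap f h)).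
apply: eq_mmap => [c|j] /=; first by rewrite mmapC.
by rewrite mmapX mmap1U.
Qed.

Lemma dhomog_mpolyX1 k (j : 'I_k) : mpolyX R (mnm1 j) \is ishomog1 1 mdeg.
Proof. by rewrite dhomogX /= mdeg1. Qed.

Lemma widen1_homog n P : P \is ishomog1 n mdeg -> widen1 P \is ishomog1 n mdeg.
Proof.
move=> /dhomogP Ph; rewrite /widen1 /mmap big_seq.
apply: rpred_sum => m /Ph /= mn; rewrite mul_mpolyC; apply: rpredZ.
rewrite -mn mdegE /mmap1.
elim/big_rec2: _ => [|j q k _ IH]; first exact: dhomog1.
apply: dhomogM => //; elim: (m j) => [|s IHs].
  by rewrite expr0 dhomog1.
by rewrite exprS; have := dhomogM (dhomog_mpolyX1 (lshift 1 j)) IHs; rewrite add1n.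
Qed.

End Widen.

Section Concavity.
Variables (R : realType) (d n : nat) (q : mpoly d R) (e : 'rV[R]_d).
Hypotheses (qh : homogeneous n.+1 q) (qe : hyperbolic q e).
Implicit Types (x y : 'rV[R]_d) (r a : R).
Let q' := dd e q.

Let Q : mpoly (d + 1) R :=
  widen1 q - mpolyX R (mnm1 (rshift d ord0)) * widen1 q'.

Let pt x r : 'rV[R]_(d + 1) := row_mx x (const_mx r).

Let Qh : homogeneous n.+1 Q.
Proof.
rewrite /homogeneous /Q; apply: rpredB; first exact: widen1_homog.
have := dhomogM (dhomog_mpolyX1 R (rshift d ord0))
  (widen1_homog (dd_homog e qh)).
by rewrite add1n.
Qed.

Let lin_Q x r :
  lin Q (pt x r) (pt e 0) = lin q x e - r *: (lin q x e)^`().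
Proof.
rewrite {1}/lin /Q rmorphB rmorphM /= !mmap_widen1 mmapX mmap1U.
rewrite /pt !row_mxEr !mxE mul0r addr0 mul_polyC -lin_dd; congr (_ - _ *: _).
  by apply: eq_mmap => // j; rewrite !row_mxEl.
by apply: eq_mmap => // j; rewrite !row_mxEl.
Qed.

Let polyfun_Q x r : polyfun Q (pt x r) = polyfun q x - r * polyfun q' x.
Proof.
rewrite (polyfun_lin0 _ _ (pt e 0)) lin_Q coefB coefZ coef_deriv mulr1n.
by rewrite -polyfun_lin0 /q' polyfun_dd.
Qed.

(** Along [(e, 0)] the variable [r] is constant, and [L - r L'] is real-rooted with [L]. *)
Let Qe : hyperbolic Q (pt e 0).
Proof.
apply/hyperbolicE; split.
  by rewrite polyfun_Q mul0r subr0; case: qe.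
move=> z; have -> : z = pt (lsubmx z) (z ord0 (rshift d ord0)).
  rewrite /pt -{1}[z]hsubmxK; congr row_mx.
  by apply/matrixP => a b; rewrite !mxE !ord1.
rewrite lin_Q -{1}[lin q _ _]scale1r -scaleNr.
apply: real_rooted_comb; first exact: lin_real_rooted.
  by rewrite (size_lin_hyp qh qe).
by rewrite oner_eq0.
Qed.

(* [Q (x, r) = q x - r q' x] is hyperbolic in the direction [(e, 0)], and its
   cone is the open subgraph of the ratio [q / q'], which is therefore concave. *)
Lemma ocone_subgraph x r : ocone q' e x ->
  r < polyfun q x / polyfun q' x -> ocone Q (pt e 0) (pt x r).
Proof.
move=> Cx rq; have Lgt j : (j <= n)%N -> 0 < (lin q x e)`_j.+1.
  have := (@ocone_iter_ddP R d n.+1 q e qh qe 1 isT x).1 Cx j.+1.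
  by rewrite ltnS.
apply/(oconeP Qh Qe) => j; rewrite lin_Q coefB coefZ coef_deriv.
set L := lin q x e in Lgt *.
have LR : real_rooted L by exact: lin_real_rooted.
have sL : size L = n.+2 by rewrite (size_lin_hyp qh qe).
(* If [r <= 0] the signs suffice. Otherwise Newton's inequality makes the ratios
   [L_j / ((j + 1) L_(j+1))] increase with [j], so that [r], being below the first one, is below
   them all. *)
elim: j => [|j IHj] jn.
  rewrite mulr1n subr_gt0 -polyfun_lin0 -polyfun_dd -/q'.
  by rewrite -ltr_pdivlMr // /q' polyfun_dd Lgt.
have [jn'|] := ltnP j n; last first.
  move=> nj; rewrite [L`_j.+2]nth_default ?sL // mul0rn mulr0 subr0.
  exact: Lgt.
have L1 := Lgt _ (ltnW jn'); have L2 := Lgt _ jn'.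
rewrite subr_gt0; have [r0|r0] := leP r 0.
  apply: le_lt_trans L1; rewrite mulr_le0_ge0 // mulrn_wge0 // ltW //.
have := IHj (ltnW jn); rewrite subr_gt0 => Lj.
have L0 : 0 < L`_j.
  by apply: le_lt_trans Lj; rewrite mulr_ge0 ?mulrn_wge0 // ltW.
have := @coef_newton _ L j LR; rewrite sL => /(_ jn (lt0r_neq0 L0)).
have nE (u : R) k : u *+ k = u * k%:R by rewrite mulr_natr.
rewrite (nE L`_j) !(nE L`_j.+1) !(nE L`_j.+2) !factS !natrM => N.
rewrite (nE L`_j.+1) in Lj.
have f0 : 0 < j`!%:R :> R by rewrite ltr0n fact_gt0.
have a0 : 0 < j.+1%:R :> R by rewrite ltr0n.
have b0 : 0 < j.+2%:R :> R by rewrite ltr0n.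
move: (j`!%:R) (j.+1%:R) (j.+2%:R) L`_j L`_j.+1 L`_j.+2 f0 a0 b0 L0 L1 L2 N Lj.
move=> f a b l0 l1 l2 f0 a0 b0 l00 l10 l20 N Lj.
have {}N : b * l0 * l2 < a * l1 ^+ 2.
  have k0 : 0 < f ^+ 2 * a by rewrite mulr_gt0 ?exprn_gt0.
  by rewrite -(ltr_pM2l k0); lra.
have bl : 0 < b * l2 by rewrite mulr_gt0.
rewrite -(ltr_pM2l bl) in Lj.
have al : 0 < a * l1 by rewrite mulr_gt0.
by rewrite -(ltr_pM2l al); lra.
Qed.

(** The open subgraph is closed under addition, being a cone of [Q]; half of a supposed defect, [c],
    moves both points strictly below the graph. With [ratioZ] this is concavity. *)
Lemma ratio_superadd x y : ocone q' e x -> ocone q' e y ->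
  polyfun q x / polyfun q' x + polyfun q y / polyfun q' y <=
  polyfun q (x + y) / polyfun q' (x + y).
Proof.
move=> Cx Cy; set a := _ / _; set b := _ / _.
have q'h := dd_homog e qh; have q'e := @hyperbolic_iter_dd R d n.+1 q e qh qe 1 isT.
have q'0 : 0 < polyfun q' (x + y).
  exact: ocone_gt0 (ocone_add q'h q'e Cx Cy).
rewrite leNgt; apply/negP => lt_ab.
pose c := (a + b - polyfun q (x + y) / polyfun q' (x + y)) / 2.
have c0 : 0 < c by rewrite divr_gt0 // subr_gt0.
have ltc u : u - c < u by rewrite ltrBlDr ltrDl.
have := ocone_gt0 (ocone_add Qh Qe (ocone_subgraph Cx (ltc a))
  (ocone_subgraph Cy (ltc b))).
have -> : pt x (a - c) + pt y (b - c) = pt (x + y) (a - c + (b - c)).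
  by rewrite /pt add_row_mx; congr row_mx; apply/matrixP => u v; rewrite !mxE.
rewrite polyfun_Q subr_gt0 -ltr_pdivlMr //.
by rewrite /c; lra.
Qed.

Lemma ratioZ x a : polyfun q (a *: x) / polyfun q' (a *: x) =
  a * (polyfun q x / polyfun q' x).
Proof.
rewrite (polyfunZ _ _ qh) (polyfunZ _ _ (dd_homog e qh)) /= exprS.
have [->|a0] := eqVneq a 0; first by rewrite !mul0r.
rewrite -[a * _ * _]mulrA -[LHS]mulrA; congr (a * _).
by rewrite -mulf_div divff ?mul1r // expf_neq0.
Qed.

End Concavity.

(** * Curvature of the boundary of a derivative cone *)

Lemma poly_eq0_inj (R : numDomainType) (p : {poly R}) (f : nat -> R) :
  injective f -> (forall j, p.[f j] = 0) -> p = 0.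
Proof.
move=> finj p0; apply/eqP/negPn/negP => pn0.
pose rs := [seq f j | j <- iota 0 (size p)].
have rsU : uniq rs by rewrite map_inj_uniq ?iota_uniq.
have rsR : all (root p) rs.
  by apply/allP => _ /mapP[j _ ->]; apply/rootP.
by have := max_poly_roots pn0 rsR rsU; rewrite size_map size_iota ltnn.
Qed.

Lemma poly_eq0_except (R : numDomainType) (p : {poly R}) a :
  (forall s, s != a -> p.[s] = 0) -> p = 0.
Proof.
move=> p0; apply: (@mulfI _ ('X - a%:P)); first by rewrite polyXsubC_eq0.
rewrite mulr0; apply: (@poly_eq0_inj _ _ (fun j => j%:R)) => [j k|j].
  by move/eqP; rewrite eqr_nat => /eqP.
rewrite hornerM hornerXsubC.
by have [->|/p0 ->] := eqVneq j%:R a; rewrite ?subrr ?mul0r ?mulr0.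
Qed.

Lemma poly_ge0_at0 (R : realType) (p : {poly R}) :
  (forall t, 0 < t -> 0 <= p.[t]) -> 0 <= p.[0].
Proof.
move=> pt; rewrite leNgt; apply/negP => p0.
have : nbhs p.[0] [set u : R | u < 0].
  by apply: open_nbhs_nbhs; split; [exact: open_lt|].
move=> /(continuous_horner (p := p) (x := 0)) /nbhs_ballP[t /= t0 tB].
have : p.[t / 2] < 0.
  apply: tB; rewrite /ball /= sub0r normrN gtr0_norm ?divr_gt0 //; lra.
by rewrite ltNge pt // divr_gt0.
Qed.

Section Boundary.
Variables (R : realType) (d k : nat) (q : mpoly d R) (e : 'rV[R]_d).
Hypotheses (qh : homogeneous k q) (qe : hyperbolic q e).
Implicit Types (x y w : 'rV[R]_d).

(** [s |-> q (y + s w)] is the reversal of [t |-> q (w + t y)], which has degree exactly [k].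
    Entries [t = 0] of the list account for a drop of degree. *)
Lemma lin_reverse y w : hyperbolic q y -> exists2 s, size s = k &
  lin q y w = polyfun q y *: \prod_(t <- s) (1 - t *: 'X).
Proof.
move=> qy; have [s sE] := real_rooted_split (@lin_real_rooted _ _ _ _ qy w).
have qy0 : polyfun q y != 0 by rewrite gt_eqF // (hyperbolic_gt0 qy).
rewrite (lead_coef_lin _ qh qy0) in sE.
have ss : size s = k.
  have := size_lin w qh qy0.
  by rewrite sE size_scale // size_prod_XsubC => -[].
exists s => //; apply/eqP; rewrite -subr_eq0; apply/eqP.
apply: (@poly_eq0_except _ _ 0) => u u0.
rewrite hornerD hornerN; apply/eqP; rewrite subr_eq0; apply/eqP.
rewrite horner_lin hornerZ horner_prod.
have -> : y + u *: w = u *: (w + u^-1 *: y).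
  by rewrite scalerDr scalerA divff // scale1r addrC.
rewrite (polyfunZ _ _ qh) -horner_lin sE hornerZ horner_prod mulrCA.
congr (_ * _); rewrite -ss; elim: s {sE ss} => [|t s IHs].
  by rewrite !big_nil expr0 mulr1.
rewrite !big_cons /= exprS -IHs mulrACA; congr (_ * _).
rewrite hornerXsubC mulrBr divff // hornerD hornerN hornerC hornerZ hornerX.
by rewrite [u * t]mulrC.
Qed.

Lemma coef1_lin v x w t : (lin (dd w q) x v).[t] = (lin q (x + t *: v) w)`_1.
Proof. by rewrite horner_lin polyfun_dd. Qed.

Section Tangent.
Variables (x w : 'rV[R]_d).
Hypotheses (Cx : ccone q e x) (qx : polyfun q x = 0).
Hypotheses (q'x : 0 < polyfun (dd e q) x) (qw : polyfun (dd w q) x = 0).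

Let A0 := lin q x e.
Let A1 := lin (dd w q) x e.
Let A2 := lin (iter 2 (dd w) q) x e.

Let factor_X (A : {poly R}) : A`_0 = 0 -> exists2 B, A = 'X * B & B.[0] = A`_1.
Proof.
move=> A00; have /factor_theorem[B ->] : root A 0.
  by apply/rootP; rewrite horner_coef0.
rewrite polyC0 subr0 mulrC; exists B => //.
by rewrite horner_coef0 coefXM.
Qed.

(** For [t > 0] the point [x + t e] is in the open cone, hence a direction, and Newton's identity
    applies along [w]. *)
Let expand t : 0 < t -> exists2 s, size s = k &
  (A1.[t] ^+ 2 - A0.[t] * A2.[t] = A0.[t] ^+ 2 * \sum_(u <- s) u ^+ 2) /\
  lin q (x + t *: e) w = A0.[t] *: \prod_(u <- s) (1 - u *: 'X).
Proof.
move=> t0; have Cy := ccone_ocone qh qe Cx t0.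
have [s ss sE] := lin_reverse w (garding_direction qh qe Cy).
exists s => //; rewrite /A0 horner_lin; split=> //.
have [P0 P2] := newton_prod_1subX s.
rewrite /A1 coef1_lin /A2 horner_lin (polyfun_iter_dd _ _ _ w) sE !coefZ.
rewrite -P2 P0 -[_ *+ 2`!]mulr_natr (_ : 2`! = 2)%N //.
set a := polyfun q _; set b := _`_1.
by set c := _`_2; ring.
Qed.

Lemma tangent_second_order : polyfun (iter 2 (dd w) q) x <= 0.
Proof.
have [B0 A0E B00] : exists2 B, A0 = 'X * B & B.[0] = A0`_1.
  by apply: factor_X; rewrite -polyfun_lin0.
have [B1 A1E _] : exists2 B, A1 = 'X * B & B.[0] = A1`_1.
  by apply: factor_X; rewrite -polyfun_lin0.
(* Newton's inequality divided by [t], since [A0] and [A1] vanish at 0; at [t = 0] it reads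
   [0 <= - D_e q x * D_w^2 q x]. *)
have /poly_ge0_at0 : forall t, 0 < t -> 0 <= ('X * B1 ^+ 2 - B0 * A2).[t].
  move=> t t0; rewrite -(pmulr_rge0 _ t0).
  have [s _ [sE _]] := expand t0.
  have -> : t * ('X * B1 ^+ 2 - B0 * A2).[t] =
      A1.[t] ^+ 2 - A0.[t] * A2.[t].
    by rewrite A0E A1E !(hornerD, hornerN, hornerM, hornerX, horner_exp); ring.
  rewrite sE mulr_ge0 ?sqr_ge0 // sumr_ge0 // => u _.
  exact: sqr_ge0.
rewrite hornerD hornerN !hornerM hornerX mul0r sub0r oppr_ge0 B00.
rewrite -polyfun_dd pmulr_rle0 //.
by rewrite horner_coef0 -polyfun_lin0.
Qed.

(* If the second derivative vanishes too, the squares of the inverse roots of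
   [s |-> q (x + t e + s w)] stay bounded as [t] tends to 0, while the value at
   [s = 0] tends to 0. *)
Lemma tangent_line : polyfun (iter 2 (dd w) q) x = 0 ->
  forall s, polyfun q (x + s *: w) = 0.
Proof.
move=> qww s.
have [B0 A0E B00] : exists2 B, A0 = 'X * B & B.[0] = A0`_1.
  by apply: factor_X; rewrite -polyfun_lin0.
have [B1 A1E _] : exists2 B, A1 = 'X * B & B.[0] = A1`_1.
  by apply: factor_X; rewrite -polyfun_lin0.
have [B2 A2E _] : exists2 B, A2 = 'X * B & B.[0] = A2`_1.
  by apply: factor_X; rewrite -polyfun_lin0.
(* For [t > 0] this is [B0 ^ 2 * (1 + |s| (1 + T))], with [T] the sum of the squares [u ^ 2] of the
   inverse roots; the bracket bounds each factor [|1 - u s|], as [|u| <= 1 + T]. Multiplying by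
   powers of [B0 ^ 2] keeps the estimate polynomial in [t]. *)
pose N := B0 ^+ 2 + `|s| *: (B0 ^+ 2 + (B1 ^+ 2 - B0 * B2)).
pose F := lin q (x + s *: w) e.
have bound t : 0 < t ->
    `|F.[t]| * (B0.[t] ^+ 2) ^+ k <= t * B0.[t] * N.[t] ^+ k.
  move=> t0; have [r rk [rE rP]] := expand t0.
  have A0t : A0.[t] = t * B0.[t] by rewrite A0E hornerM hornerX.
  have B0t : 0 < B0.[t].
    rewrite -(pmulr_rgt0 _ t0) -A0t horner_lin.
    exact: ocone_gt0 (ccone_ocone qh qe Cx t0).
  have -> : F.[t] = t * B0.[t] * (\prod_(u <- r) (1 - u *: 'X)).[s].
    rewrite -A0t -hornerZ -rP !horner_lin; congr polyfun.
    by rewrite addrAC.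
  rewrite normrM gtr0_norm ?mulr_gt0 // -[leLHS]mulrA ler_pM2l ?mulr_gt0 //.
  set T := \sum_(u <- r) u ^+ 2 in rE.
  have NE : N.[t] = B0.[t] ^+ 2 * (1 + `|s| * (1 + T)).
    have : B0.[t] ^+ 2 * T = B1.[t] ^+ 2 - B0.[t] * B2.[t].
      apply: (mulfI (_ : t ^+ 2 != 0)); first by rewrite expf_neq0 // gt_eqF.
      rewrite mulrA -exprMn -A0t -rE A0E A1E A2E !hornerM !hornerX; ring.
    rewrite /N hornerD hornerZ !(hornerD, hornerN, hornerM, horner_exp).
    by move=> <-; ring.
  rewrite NE [leRHS]exprMn mulrC ler_pM2l ?exprn_gt0 //.
  rewrite horner_prod normr_prod -rk.
  have Tge u : u \in r -> `|u| <= 1 + T.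
    move=> ur; have : u ^+ 2 <= T.
      rewrite /T (big_rem u) //= lerDl sumr_ge0 // => v _.
      exact: sqr_ge0.
    rewrite -real_normK ?num_real //; have := normr_ge0 u; nra.
  elim: (r) Tge => [|u r' IH] Tge; first by rewrite big_nil expr0.
  rewrite big_cons exprS; apply: ler_pM; rewrite ?normr_ge0 ?prodr_ge0 //;
    last by apply: IH => v vr; rewrite Tge // inE vr orbT.
  rewrite hornerD hornerN hornerC hornerZ hornerX.
  rewrite (le_trans (ler_normB _ _)) // normr1 lerD2l normrM mulrC.
  by rewrite ler_wpM2l // Tge // mem_head.
have B0p : 0 < (B0.[0] ^+ 2) ^+ k.
  by rewrite !exprn_gt0 // B00 -polyfun_dd.
have F0 : F.[0] = polyfun q (x + s *: w) by rewrite horner_coef0 -polyfun_lin0.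
have sgn (a : R) : `|a| = 1 -> a * F.[0] <= 0.
  move=> a1.
  have : 0 <= ('X * B0 * N ^+ k - a *: F * (B0 ^+ 2) ^+ k).[0].
    apply: poly_ge0_at0 => t t0.
    rewrite hornerD hornerN !hornerM hornerZ !horner_exp hornerX.
    rewrite subr_ge0 (le_trans _ (bound t t0)) // ler_wpM2r //.
      by rewrite exprn_ge0 // sqr_ge0.
    by rewrite (le_trans (ler_norm _)) // normrM a1 mul1r.
  rewrite hornerD hornerN !hornerM hornerZ !horner_exp hornerX !mul0r sub0r.
  by rewrite oppr_ge0 pmulr_lle0.
rewrite -F0; apply/le_anti/andP; split.
  by have := sgn 1 (normr1 _); rewrite mul1r.
by have := sgn (-1) (normrN1 _); rewrite mulN1r oppr_le0.
Qed.

End Tangent.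
End Boundary.

(** * Lines of zeros through a point of a derivative cone *)

Section Rigidity.
Variables (R : realType) (d n : nat) (P : mpoly d R) (e : 'rV[R]_d).
Hypotheses (Ph : homogeneous n P) (Pe : hyperbolic P e).
Hypothesis pointed : forall z, (forall a, ccone P e (a *: z)) -> z = 0.
Variable i : nat.
Hypothesis lt_in : (i.+1 < n)%N.
Implicit Types (x y w z : 'rV[R]_d).
Let q := iter i (dd e) P.
Let le_in : (i <= n)%N.
Proof. by rewrite ltnW // ltnW. Qed.
Let qh : homogeneous (n - i) q.
Proof. exact: iter_dd_homog. Qed.
Let qe : hyperbolic q e.
Proof. exact: (hyperbolic_iter_dd Ph Pe). Qed.

(* The sum of the eigenvalues, up to a positive factor: a linear form that is
   positive on the nonzero points of the derivative cone. *)
Let l z : R := (lin P z e)`_n.-1.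

Lemma trace_linear z x a : l (z + a *: x) = l z + a * l x.
Proof.
have n0 : (0 < n)%N by rewrite (leq_ltn_trans _ lt_in).
pose G := iter n.-1 (dd e) P.
have Gh : homogeneous 1 G.
  have nn : (n - n.-1 = 1)%N by rewrite -subn1 subKn.
  by have := iter_dd_homog n.-1 e Ph; rewrite nn.
have lE u : l u = (n.-1)`!%:R^-1 * polyfun G u.
  rewrite /G (polyfun_iter_dd _ _ _ e) -/(l u) -(mulr_natr (l u)) mulrCA.
  by rewrite mulVf ?mulr1 // pnatr_eq0 -lt0n fact_gt0.
rewrite !lE mulrCA -mulrDr; congr (_ * _); rewrite -horner_lin.
rewrite (horner_coef_wide _ (size_lin_leq z x Gh)) !big_ord_recl big_ord0.
rewrite expr0 mulr1 addr0 /= /bump /= expr1 (coef_lin _ _ Gh).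
by rewrite -polyfun_lin0 [a * _]mulrC.
Qed.

(** As [i <= n - 2], the coefficient of index [n - 2] is nonnegative; together with trace 0 this
    leaves [P (z + t e) = P e * t ^ n], so the whole line through [z] and 0 lies in the cone of
    [P]. *)
Lemma ccone_trace_eq0 z : ccone q e z -> l z = 0 -> z = 0.
Proof.
move=> /(ccone_iter_ddP P e) Cz lz; apply: pointed => a.
have n2 : n = (n - 2).+2 by rewrite -addn2 subnK // (leq_ltn_trans _ lt_in).
have n1 : n.-1 = (n - 2).+1 by rewrite [in LHS]n2.
have L0 : forall j, (j <= (n - 2).+1)%N -> (lin P z e)`_j = 0.
  apply: coef_sum0.
  - exact: lin_real_rooted.
  - by rewrite (size_lin_hyp Ph Pe) {1}n2.
  - exact: (lead_coef_lin_gt0 Ph Pe).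
  - by apply: Cz; rewrite -ltnS -n1 -ltnS prednK // (leq_ltn_trans _ lt_in).
  - by rewrite -n1.
apply/(cconeP Ph Pe) => t t0.
have [->|a0] := eqVneq a 0.
  rewrite scale0r add0r (polyfunZ _ _ Ph).
  by rewrite mulr_gt0 ?exprn_gt0 // (hyperbolic_gt0 Pe).
rewrite (polyfun_scale_dir _ Ph) // -horner_lin horner_coef (size_lin_hyp Ph Pe).
rewrite big_ord_recr big1 /= ?add0r => [|j _].
  rewrite (coef_lin _ _ Ph) mulrCA -exprMn mulrCA divff // mulr1.
  by rewrite mulr_gt0 ?exprn_gt0 // (hyperbolic_gt0 Pe).
by rewrite L0 ?mul0r // -n1 -ltnS prednK // (leq_ltn_trans _ lt_in).
Qed.

Lemma ccone_trace_gt0 z : ccone q e z -> z != 0 -> 0 < l z.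
Proof.
move=> Cz z0; rewrite lt_def; apply/andP; split.
  by apply: contraNN z0 => /eqP/(ccone_trace_eq0 Cz) ->.
have n0 : (0 < n)%N by rewrite (leq_ltn_trans _ lt_in).
apply: ((ccone_iter_ddP P e i z).1 Cz).
by rewrite -ltnS prednK // ltnW.
Qed.

Lemma ccone_double_root y : ccone q e y -> polyfun q y = 0 ->
  polyfun (dd e q) y = 0 -> ccone P e y.
Proof.
move=> /(ccone_iter_ddP P e) Cy; rewrite -[dd e q]/(iter i.+1 (dd e) P).
rewrite !(polyfun_iter_dd _ _ _ e).
move=> /eqP; rewrite mulrn_eq0 -[_`! == 0]negbK -lt0n fact_gt0 /= => /eqP y0.
move=> /eqP; rewrite mulrn_eq0 -[_`! == 0]negbK -lt0n fact_gt0 /= => /eqP y1.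
move=> j; have [ij|ji] := leqP i j; first exact: Cy.
rewrite (@coef_zeros _ (lin P y e) i) //.
- exact: lin_real_rooted.
- by rewrite (size_lin_hyp Ph Pe).
- by rewrite ltnW // ltnW.
Qed.

Lemma ccone_lim x w u0 :
  (forall t, 0 < t -> exists2 u, `|u - u0| < t & ccone q e (x + u *: w)) ->
  ccone q e (x + u0 *: w).
Proof.
move=> H; rewrite ((closure_id (ccone q e)).1 (ccone_closed (e := e) (P := q))).
move=> B xB.
have : (fun t => x + t *: w) @ u0 --> x + u0 *: w.
  by apply: cvgD; [exact: cvg_cst|exact: scalel_continuous].
move=> /(_ _ xB) /nbhs_ballP[t /= t0 tB].
have [u ut Cu] := H _ t0; exists (x + u *: w); split=> //.
by apply: tB; rewrite /ball /= distrC.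
Qed.

(* Moving from [x] along a line of zeros of [q], the last point of the
   derivative cone has a double eigenvalue 0, hence lies in the cone of [P]. *)
Lemma exit_point x w : ccone q e x -> (forall s, polyfun q (x + s *: w) = 0) ->
  l w = 0 -> w != 0 -> exists2 s, 0 <= s & ccone P e (x + s *: w).
Proof.
move=> Cx q0 lw w0.
pose S := [set s : R | 0 <= s /\ ccone q e (x + s *: w)].
have S0 : S 0 by split=> //; rewrite scale0r addr0.
have hS : has_sup S.
  split; first by exists 0.
  (* Were [S] unbounded, [w] would be a limit of points [s^-1 (x + s w)] of the cone, and it has
     trace 0. *)
  apply: contrapT => nS; case/eqP: w0; apply: ccone_trace_eq0 => //.
  rewrite -[w]addr0 -(scale0r x); apply: ccone_lim => t t0.
  have [s [[s0 Cs] ts]] : exists s, S s /\ t^-1 < s.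
    apply: contrapT => nst; apply: nS; exists t^-1 => s Ss.
    by rewrite leNgt; apply/negP => ts; apply: nst; exists s.
  have s1 : 0 < s by rewrite (lt_trans _ ts) // invr_gt0.
  exists s^-1.
    by rewrite subr0 gtr0_norm ?invr_gt0 // -[t]invrK ltf_pV2 // posrE invr_gt0.
  have -> : w + s^-1 *: x = s^-1 *: (x + s *: w).
    by rewrite scalerDr scalerA mulVf ?gt_eqF // scale1r addrC.
  by apply: (ccone_scale qh qe) => //; rewrite invr_ge0.
pose s := sup S.
have s0 : 0 <= s by apply: sup_upper_bound.
have Cs : ccone q e (x + s *: w).
  apply: ccone_lim => t t0; have [u Su ut] := sup_adherent t0 hS.
  exists u; last by case: Su.
  have us : u <= s by apply: sup_upper_bound.
  by rewrite distrC ger0_norm ?subr_ge0 // ltrBlDl -ltrBlDr.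
exists s => //; set y := x + s *: w in Cs *.
apply: ccone_double_root => //; first exact: q0.
have q'h : homogeneous (n - i.+1) (dd e q) := iter_dd_homog i.+1 e Ph.
have q'e : hyperbolic (dd e q) e.
  by apply: (@hyperbolic_iter_dd _ _ _ _ _ Ph Pe i.+1); rewrite ltnW.
have Cy' : ccone (dd e q) e y.
  apply/(@ccone_iter_ddP _ _ P e i.+1) => j ij.
  by apply: ((ccone_iter_ddP P e i y).1 Cs); rewrite ltnW.
have y'0 : 0 <= polyfun (dd e q) y by rewrite (polyfun_lin0 _ _ e); exact: Cy'.
(* If [D_e q y > 0], a slightly farther point of the line is still in the open cone of [D_e q]; as
   [q] vanishes there, it is in the cone of [q], beyond the supremum. *)
apply/le_anti; rewrite y'0 andbT leNgt; apply/negP => y'1.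
have Oy' := ccone_gt0_ocone q'h q'e Cy' y'1.
have : (fun t => y + t *: w) @ 0 --> y + 0 *: w.
  by apply: cvgD; [exact: cvg_cst|exact: scalel_continuous].
rewrite scale0r addr0 => /(_ (ocone (dd e q) e)) [].
  by apply: open_nbhs_nbhs; split=> //; exact: (ocone_open q'h q'e).
move=> t /= t0 tB.
have Ot : ocone (dd e q) e (y + (t / 2) *: w).
  apply: tB; rewrite /ball /= sub0r normrN gtr0_norm ?divr_gt0 //; lra.
suff : S (s + t / 2).
  by move/(sup_upper_bound hS); rewrite -/s; lra.
split; first by rewrite addr_ge0 // divr_ge0 // ltW.
rewrite scalerDl addrA -/y; apply/(ccone_iter_ddP P e) => j.
rewrite leq_eqVlt => /predU1P[<-|ij].
  have := q0 (s + t / 2); rewrite scalerDl addrA -/y (polyfun_iter_dd _ _ _ e).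
  by move=> /eqP; rewrite mulrn_eq0 -[_`! == 0]negbK -lt0n fact_gt0 /= => /eqP ->.
have [jn|nj] := leqP j n; last by rewrite (coef_lin_gt Ph Pe).
apply/ltW; apply: ((@ocone_iter_ddP _ _ _ _ _ Ph Pe i.+1 (ltnW lt_in) _).1 Ot).
by rewrite ij.
Qed.

Lemma zero_line_radial x w : ccone q e x -> ~ ccone P e x ->
  (forall s, polyfun q (x + s *: w) = 0) -> exists a, w = a *: x.
Proof.
move=> Cx nCx q0.
have x0 : x != 0 by apply/eqP => x0; apply: nCx; rewrite x0; exact: (ccone0 Ph Pe).
have lx := ccone_trace_gt0 Cx x0.
pose a := l w / l x; exists a; apply/eqP; rewrite -subr_eq0.
apply/negPn/negP; set v := w - a *: x => v0.
have lv : l v = 0.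
  by rewrite /v -scaleNr trace_linear mulNr /a divfK ?subrr // gt_eqF.
have qv s : polyfun q (x + s *: v) = 0.
  rewrite -horner_lin.
  suff -> : lin q x v = 0 by rewrite horner0.
  (* Homogeneity carries zeros from the line along [w] to the one along [v], except at [u = 1 / a].
     For [a = 0] the excluded value is 0, by the convention on inverses. *)
  apply: (@poly_eq0_except _ _ a^-1) => u ua.
  have au : 1 - u * a != 0.
    rewrite subr_eq0; apply: contraNN ua => /eqP ua.
    have a0 : a != 0.
      by apply/eqP => a0; move/eqP: ua; rewrite a0 mulr0 oner_eq0.
    by rewrite -[u](mulfK a0) -ua mul1r.
  rewrite horner_lin.
  have -> : x + u *: v = (1 - u * a) *: (x + (u / (1 - u * a)) *: w).
    rewrite [RHS]scalerDr scalerA [_ * (u / _)]mulrCA divff // mulr1.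
    rewrite scalerBl scale1r.
    by rewrite /v scalerBr scalerA addrAC addrA.
  by rewrite (polyfunZ _ _ qh) q0 mulr0.
have [s s0 Cs] := exit_point Cx qv lv v0.
have [] := @exit_point x (- v) Cx.
- by move=> u; rewrite scalerN -scaleNr.
- have dbl (u : 'rV[R]_d) : - u = u + (- 2) *: u.
    by rewrite scaleNr scaler_nat mulr2n opprD addrA subrr add0r.
  by rewrite dbl trace_linear lv mulr0 addr0.
- by rewrite oppr_eq0.
move=> t t0 Ct; apply: nCx.
have [s00|s1] := eqVneq s 0; first by move: Cs; rewrite s00 scale0r addr0.
have st : 0 < s + t by rewrite ltr_pwDl // lt_def s1.
have -> : x = (s + t)^-1 *: (t *: (x + s *: v) + s *: (x + t *: - v)).
  have comb (u : 'rV[R]_d) :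
      t *: (x + s *: u) + s *: (x + t *: - u) = (s + t) *: x.
    rewrite !scalerDr !scalerN !scalerA [s * t]mulrC addrACA subrr addr0.
    by rewrite -scalerDl addrC.
  by rewrite comb scalerA mulVf ?scale1r // gt_eqF.
apply: (ccone_scale Ph Pe); first by rewrite invr_ge0 ltW.
by apply: (ccone_add Ph Pe); apply: (ccone_scale Ph Pe).
Qed.

End Rigidity.

(** * The barrier along a line *)

Section OneVariable.
Variable R : realType.
Implicit Types (A B L M N : {poly R}) (s : R).

(** The difference quotients coincide, so the identity holds at every [s] and inner derivatives can
    be rewritten as functions. *)
Lemma derive_line (d : nat) (g : 'rV[R]_d -> R) (y v : 'rV[R]_d) s :
  'D_v (g : _ -> R^o) (y + s *: v) = 'D_1 (fun u : R => g (y + u *: v) : R^o) s.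
Proof.
have gE : (fun h : R =>
    h^-1 *: (((g : _ -> R^o) \o shift (y + s *: v)) (h *: v) - g (y + s *: v)))
  = (fun h : R => h^-1 *: (((fun u : R => g (y + u *: v) : R^o) \o shift s)
       (h *: 1) - g (y + s *: v))).
  by apply/funext => h /=; rewrite [h *: 1]mulr1 scalerDl addrCA.
by rewrite /derive gE.
Qed.

Lemma poly_gt0_near A s : 0 < A.[s] -> \forall t \near s, 0 < A.[t].
Proof.
move=> As; have : nbhs A.[s] [set u : R | u > 0].
  by apply: open_nbhs_nbhs; split; [exact: open_gt|].
exact: (continuous_horner (p := A) (x := s)).
Qed.

Lemma is_derive_ratio A B s : B.[s] != 0 ->
  is_derive s 1 (fun t : R => A.[t] / B.[t])
    ((A^`() * B - A * B^`()).[s] / (B ^+ 2).[s]).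
Proof.
move=> Bs.
have dB := is_deriveV Bs (is_derive_poly B s).
have dAB := is_deriveM (is_derive_poly A s) dB.
apply: (is_derive_eq dAB).
rewrite !(hornerD, hornerN, hornerM, horner_exp) /GRing.scale /=.
by field.
Qed.

Lemma is_derive_ln_poly L s : 0 < L.[s] ->
  is_derive s 1 (fun t : R => ln L.[t]) (L^`().[s] / L.[s]).
Proof.
move=> Ls; have := is_derive1_comp (is_derive1_ln Ls) (is_derive_poly L s).
by rewrite mulrC.
Qed.

(** The objective along [x + s v], with [L] the gap [c (e - x - s v)] and [M], [N] the restrictions
    of [q], [q']. *)
Definition barrier L M N s : R := - ln L.[s] - M.[s] / N.[s].

Let W M N := M^`() * N - M * N^`().

Definition barrier1 L M N s : R :=
  - (L^`().[s] / L.[s]) - (W M N).[s] / (N ^+ 2).[s].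

Lemma is_derive_barrier L M N s : 0 < L.[s] -> 0 < N.[s] ->
  is_derive s 1 (barrier L M N) (barrier1 L M N s).
Proof.
move=> Ls Ns; rewrite /barrier1 /W.
have dL := is_deriveN (is_derive_ln_poly Ls).
exact: (is_deriveB dL (is_derive_ratio M (lt0r_neq0 Ns))).
Qed.

Lemma is_derive_barrier1 L M N : 0 < L.[0] -> 0 < N.[0] -> M.[0] = 0 ->
  is_derive (0 : R) 1 (barrier1 L M N)
    ((L^`().[0] ^+ 2 - L^`()^`().[0] * L.[0]) / L.[0] ^+ 2 -
     (M^`()^`().[0] * N.[0] - 2 * M^`().[0] * N^`().[0]) / N.[0] ^+ 2).
Proof.
move=> Ls Ns M0.
have dL := is_deriveN (is_derive_ratio L^`() (lt0r_neq0 Ls)).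
have N2 : (N ^+ 2).[0] != 0 by rewrite horner_exp expf_neq0 // gt_eqF.
have dW := is_deriveB dL (is_derive_ratio (W M N) N2).
apply: (is_derive_eq dW).
rewrite /W expr2 !derivM !derivB !derivM.
rewrite !(hornerD, hornerN, hornerM, horner_exp) M0.
by field; rewrite !gt_eqF.
Qed.

Lemma derive2_barrier L M N : 0 < L.[0] -> 0 < N.[0] -> M.[0] = 0 ->
  'D_1 (fun s : R => 'D_1 (barrier L M N : R -> R^o) s : R^o) 0 =
  (L^`().[0] ^+ 2 - L^`()^`().[0] * L.[0]) / L.[0] ^+ 2 -
     (M^`()^`().[0] * N.[0] - 2 * M^`().[0] * N^`().[0]) / N.[0] ^+ 2.
Proof.
move=> L0 N0 M0; rewrite -(@derive_val _ _ _ _ _ _ _ (is_derive_barrier1 L0 N0 M0)).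
apply: near_eq_derive.
have Lt := poly_gt0_near L0; have Nt := poly_gt0_near N0.
near=> t; apply: (@derive_val _ _ _ _ _ _ _ (@is_derive_barrier L M N t _ _)).
- by near: t.
- by near: t.
Unshelve. all: by end_near. Qed.

(** The second derivative is controlled at 0 only: it makes [F1] positive just to the right of 0,
    where the mean value theorem applies. The bound [s < 1] keeps the point inside the segment to a
    competitor. *)
Lemma strict_increase (F F1 : R -> R) c : F1 0 = 0 -> 0 < c ->
  is_derive (0 : R) 1 F1 c ->
  (\forall t \near (0 : R), is_derive (t : R) 1 F (F1 t)) ->
  exists s, [/\ 0 < s, s < 1 & F 0 < F s].
Proof.
move=> F10 c0 dF1 /nbhs_ballP[r /= r0 rF].
have [F1' F1c] := dF1.
have : (fun h => h^-1 *: ((F1 \o shift 0) (h *: 1) - F1 0)) @ 0^' --> c.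
  by rewrite -F1c; exact: F1'.
move=> /cvgrPdist_lt /(_ c c0) /nbhs_ballP[t /= t0 tF].
pose s := Num.min (r / 2) (Num.min (t / 2) (1 / 2)).
have s0 : 0 < s by rewrite !lt_min !divr_gt0.
have sr : s < r by rewrite gt_min; apply/orP; left; lra.
have st : s < t by rewrite !gt_min; apply/orP; right; apply/orP; left; lra.
have s1 : s < 1 by rewrite !gt_min; apply/orP; right; apply/orP; right; lra.
exists s; split=> //.
have dF u : 0 <= u <= s -> is_derive u 1 F (F1 u).
  move=> /andP[u0 us]; apply: rF; rewrite /ball /= sub0r normrN ger0_norm //.
  exact: le_lt_trans us sr.
have F1pos u : 0 < u <= s -> 0 < F1 u.
  move=> /andP[u0 us].
  have : ball 0 t u.
    by rewrite /ball /= sub0r normrN gtr0_norm // (le_lt_trans us).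
  move=> /tF /(_ (lt0r_neq0 u0)) /=.
  rewrite F10 subr0 addr0 [u *: 1]mulr1 distrC ltr_norml => /andP[+ _].
  rewrite ltrBrDl subrr [u^-1 *: _]/(u^-1 * F1 u).
  by rewrite pmulr_rgt0 // invr_gt0.
have [|v|v] := @MVT R F F1 0 s s0.
- by move=> u; rewrite in_itv /= => /andP[u0 us]; apply: dF; rewrite !ltW.
- apply: derivable_within_continuous => u; rewrite in_itv /= => us.
  by have [] := dF u us.
rewrite in_itv /= subr0 => /andP[v0 vs] Fs.
by rewrite -subr_gt0 Fs mulr_gt0 // F1pos // v0 ltW.
Qed.

End OneVariable.

(** * The hyperbolic program *)

Section DirDerivAlgebra.
Variables (R : realType) (d : nat).
Implicit Types (P Q : mpoly d R) (x v w : 'rV[R]_d) (a : R).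

Lemma polyfunD P Q x : polyfun (P + Q) x = polyfun P x + polyfun Q x.
Proof. exact: mevalD. Qed.

Lemma polyfunZl P a x : polyfun (a *: P) x = a * polyfun P x.
Proof. exact: mevalZ. Qed.

Lemma dd_linear P a v w : dd (v + a *: w) P = dd v P + a *: dd w P.
Proof.
rewrite /dd scaler_sumr -big_split; apply: eq_bigr => j _ /=.
by rewrite !mxE scalerDl scalerA.
Qed.

Lemma dd_is_linear P Q a v : dd v (P + a *: Q) = dd v P + a *: dd v Q.
Proof.
rewrite /dd scaler_sumr -big_split; apply: eq_bigr => j _ /=.
by rewrite mderivD mderivZ scalerDr !scalerA mulrC.
Qed.

Lemma dd_comm P v w : dd v (dd w P) = dd w (dd v P).
Proof.
have ddE u S : dd u S = \sum_j u ord0 j *: mderiv j S by [].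
rewrite [LHS]ddE [RHS]ddE.
have ddS j u : mderiv j (dd u P) = \sum_k u ord0 k *: mderiv j (mderiv k P).
  rewrite ddE (big_morph (mderiv j) (@mderivD _ _ j) (@mderiv0 _ _ j)).
  by apply: eq_bigr => k _; rewrite mderivZ.
under eq_bigr => j _ do rewrite ddS scaler_sumr.
rewrite exchange_big; apply: eq_bigr => j _ /=.
rewrite ddS scaler_sumr; apply: eq_bigr => k _ /=.
by rewrite !scalerA mulrC mderiv_comm.
Qed.

End DirDerivAlgebra.

Lemma factor_through (R : realType) (d m : nat)
    (A : {linear 'rV[R]_d -> 'rV[R]_m}) (c : {linear 'rV[R]_d -> R^o}) :
  (forall y, exists x, A x = y) -> (forall v, A v = 0 -> c v = 0) ->
  exists y : {linear 'rV[R]_m -> R^o}, forall x, c x = y (A x).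
Proof.
move=> A_surj cA.
have [g gP] := choice A_surj.
pose y z : R^o := c (g z).
have yA x : y (A x) = c x.
  by apply/eqP; rewrite -subr_eq0 /y -linearB cA // linearB gP subrr.
have y_lin : linear y.
  move=> a u v; rewrite -[u]gP -[v]gP -linearP !yA.
  exact: linearP.
pose Y : {linear 'rV[R]_m -> R^o} :=
  HB.pack y (GRing.isLinear.Build _ _ _ _ y y_lin).
by exists Y => x; rewrite /= yA.
Qed.

Section Program.
Variables (R : realType) (d m n : nat) (P : mpoly d R) (e : 'rV[R]_d).
Hypotheses (Ph : homogeneous n P) (Pe : hyperbolic P e).
Hypothesis pointed : forall z, (forall a, ccone P e (a *: z)) -> z = 0.
Variable i : nat.
Hypothesis lt_in : (i.+1 < n)%N.
Variables (A : {linear 'rV[R]_d -> 'rV[R]_m}) (b : 'rV[R]_m).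
Variable c : {linear 'rV[R]_d -> R^o}.
Hypothesis A_surj : forall y : 'rV[R]_m, exists x : 'rV[R]_d, A x = y.
Hypothesis b_neq0 : b != 0.
Hypothesis c_notin_imA : ~ exists y : {linear 'rV[R]_m -> R^o},
        forall x : 'rV[R]_d, c x = y (A x).
Hypothesis Ae : A e = b.
Implicit Types (x y v w z : 'rV[R]_d).
Let q := iter i (dd e) P.
Let q' := dd e q.
Let feasible := [set y | A y = b /\ ccone q e y].
Let OptQ := optimal c feasible.
Let OptP := optimal c [set y | A y = b /\ ccone P e y].
Hypothesis OptQ_neq : OptQ <> OptP.

Let le_in : (i <= n)%N.
Proof. by rewrite ltnW // ltnW. Qed.
Let qh : homogeneous (n - i) q.
Proof. exact: iter_dd_homog. Qed.
Let qe : hyperbolic q e.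
Proof. exact: (hyperbolic_iter_dd Ph Pe). Qed.
Let q'h : homogeneous (n - i.+1) q'.
Proof. exact: (iter_dd_homog i.+1 e Ph). Qed.
Let q'e : hyperbolic q' e.
Proof. exact: (@hyperbolic_iter_dd _ _ _ _ _ Ph Pe i.+1 (ltnW lt_in)). Qed.

Let AL u a v : A (u + a *: v) = A u + a *: A v.
Proof. by rewrite addrC linearP addrC. Qed.

Let cL u a v : c (u + a *: v) = c u + a * c v.
Proof. by rewrite addrC linearP addrC. Qed.

(** Otherwise [c] vanishes on the kernel of [A] and factors through [A]. *)
Lemma descent_direction : exists v, A v = 0 /\ c v < 0.
Proof.
apply: contrapT => H; apply/c_notin_imA/factor_through => // v Av.
apply/le_anti/andP; split; rewrite leNgt; apply/negP => cv; apply: H.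
  by exists (- v); rewrite !linearN Av oppr0 oppr_lt0.
by exists v.
Qed.

Lemma not_multiple x v : A x = b -> A v = 0 -> v != 0 ->
  ~ exists a, v = a *: x.
Proof.
move=> Ax + v0 [a vE]; rewrite vE linearZ Ax => /eqP.
rewrite scaler_eq0 (negPf b_neq0) orbF => /eqP a0.
by move: v0; rewrite vE a0 scale0r eqxx.
Qed.

Lemma near_line (S : set 'rV[R]_d) x v : open S -> S x ->
  \forall t \near (0 : R), S (x + t *: v).
Proof.
move=> oS Sx.
have : (fun t : R => x + t *: v) @ 0 --> x + 0 *: v.
  by apply: cvgD; [exact: cvg_cst|exact: scalel_continuous].
rewrite scale0r addr0; apply.
exact: open_nbhs_nbhs.
Qed.

Lemma near0_pos (S : set R) : (\forall t \near (0 : R), S t) ->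
  exists2 t, 0 < t & S t.
Proof.
move=> /nbhs_ballP[r /= r0 rS]; exists (r / 2); first by rewrite divr_gt0.
apply: rS; rewrite /ball /= sub0r normrN gtr0_norm ?divr_gt0 //; lra.
Qed.

Lemma optimal_boundary x : OptQ x -> polyfun q x = 0.
Proof.
move=> [[Ax Cx] xmin]; apply/eqP/negPn/negP => qx0.
have qx : 0 < polyfun q x.
  by rewrite lt_def qx0 (polyfun_lin0 _ _ e) Cx.
have [v [Av cv]] := descent_direction.
have Ox := ccone_gt0_ocone qh qe Cx qx.
have [t t0 Ot] := near0_pos (near_line v (ocone_open qh qe) Ox).
have : feasible (x + t *: v).
  split; last exact: (ocone_ccone qh qe).
  by rewrite AL Av scaler0 addr0.
by move/xmin; rewrite cL lerDl pmulr_rge0 // leNgt cv.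
Qed.

Lemma ccone_sub x : ccone P e x -> ccone q e x.
Proof. by move=> Cx; apply/(ccone_iter_ddP P e) => k _. Qed.

Lemma optimal_segment x y s : OptQ x -> OptQ y -> 0 <= s <= 1 ->
  OptQ (x + s *: (y - x)).
Proof.
move=> [[Ax Cx] xmin] [[Ay Cy] ymin] /andP[s0 s1].
have cxy : c x = c y by apply/le_anti; rewrite xmin ?ymin.
split.
  split; first by rewrite AL linearB Ax Ay subrr scaler0 addr0.
  have -> : x + s *: (y - x) = (1 - s) *: x + s *: y.
    by rewrite scalerBr scalerBl scale1r addrA addrAC.
  by apply: (ccone_add qh qe); apply: (ccone_scale qh qe); rewrite // subr_ge0.
by move=> z /xmin; rewrite cL linearB cxy subrr mulr0 addr0.
Qed.

(* Otherwise [OptP] is contained in [OptQ] and some [y] in [OptQ] lies outside the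
   cone of [P]; the segment from [y] to [x] is optimal, so [q] vanishes on the
   whole line through it, which contradicts [zero_line_radial]. *)
Lemma optimal_notin_ccone x : OptQ x -> ~ ccone P e x.
Proof.
move=> Ox Cx; apply: OptQ_neq; have [[Ax Cqx] xmin] := Ox.
have xP : OptP x.
  by split=> // y [Ay Cy]; apply: xmin; split=> //; exact: ccone_sub.
apply/seteqP; split=> y; last first.
  move=> [[Ay Cy] ymin]; split; first by split=> //; exact: ccone_sub.
  by move=> z /xmin; apply: le_trans; exact: ymin.
move=> Oy; have [[Ay Cqy] ymin] := Oy.
have [Cy|nCy] := pselect (ccone P e y).
  split=> // z [Az Cz]; apply: ymin; split=> //; exact: ccone_sub.
exfalso; apply: nCy.
have q0 s : polyfun q (y + s *: (x - y)) = 0.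
  rewrite -horner_lin; set L := lin q y _.
  suff -> : L = 0 by rewrite horner0.
  (* The points [1 / (j + 1)] of the optimal segment are infinitely many zeros of [L]. *)
  apply: (@poly_eq0_inj _ _ (fun j => (j.+1%:R)^-1)) => [u v|j].
    by move/invr_inj/eqP; rewrite eqr_nat => /eqP [].
  rewrite /L horner_lin; apply/optimal_boundary/optimal_segment => //.
  by rewrite invr_ge0 ler0n invf_le1 ?ltr0n // ler1n.
apply: contrapT => nCy.
have [a xyE] := zero_line_radial Ph Pe pointed lt_in Cqy nCy q0.
have [xy|xy] := eqVneq (x - y) 0.
  by apply: nCy; move/eqP: xy; rewrite subr_eq0 => /eqP <-.
apply: (@not_multiple y (x - y)) => //; last by exists a.
by rewrite linearB Ax Ay subrr.
Qed.

(** * First- and second-order analysis at an optimal point *)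

Section AtOptimum.
Variable x : 'rV[R]_d.
Hypothesis Ox : OptQ x.

Let Ax : A x = b.
Proof. by case: Ox => [[]]. Qed.
Let Cx : ccone q e x.
Proof. by case: Ox => [[]]. Qed.
Let qx : polyfun q x = 0.
Proof. exact: optimal_boundary. Qed.
Let nCx : ~ ccone P e x.
Proof. exact: optimal_notin_ccone. Qed.

Let C'x : ccone q' e x.
Proof.
apply/(@ccone_iter_ddP _ _ P e i.+1) => j ij.
by apply: ((ccone_iter_ddP P e i x).1 Cx); rewrite ltnW.
Qed.

Let q'x : 0 < polyfun q' x.
Proof.
rewrite lt_def; apply/andP; split.
  by apply/eqP => q'0; apply: nCx; exact: (ccone_double_root Ph Pe lt_in).
by rewrite (polyfun_lin0 _ _ e); exact: C'x.
Qed.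

Let O'x : ocone q' e x.
Proof. exact: (ccone_gt0_ocone q'h q'e). Qed.

(** [e] is feasible with [q e > 0], hence not optimal. *)
Let gap : 0 < c (e - x).
Proof.
have [[_ _] xmin] := Ox.
have Fe : feasible e by split=> //; apply/(ocone_ccone qh qe)/(ocone_dir qh qe).
rewrite linearB subr_gt0 lt_def xmin // andbT; apply/eqP => cex.
have : OptQ e by split=> // y /xmin; rewrite cex.
by move/optimal_boundary => qe0; have := hyperbolic_gt0 qe; rewrite qe0 ltxx.
Qed.

(** [x] is in the open cone of [q'], so near [x] the cone of [q] is given by [q >= 0] alone, and a
    direction that increases [q] is feasible. *)
Let ascent v : A v = 0 -> 0 < polyfun (dd v q) x -> 0 <= c v.
Proof.
move=> Av qv.
have Lx : lin q x v = 'X * (lin q x v %/ 'X).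
  have /factor_theorem[B BE] : root (lin q x v) 0.
    by apply/rootP; rewrite horner_coef0 -polyfun_lin0.
  by rewrite BE polyC0 subr0 mulpK ?polyX_eq0 // mulrC.
set B := _ %/ _ in Lx.
have B0 : 0 < B.[0].
  have := congr1 (fun p : {poly R} => p`_1) Lx.
  by rewrite coefXM /= horner_coef0 => <-; rewrite -polyfun_dd.
have [t t0 [Ot Bt]] :=
  near0_pos (filterI (near_line v (ocone_open q'h q'e) O'x) (poly_gt0_near B0)).
have : feasible (x + t *: v).
  split; first by rewrite AL Av scaler0 addr0.
  apply/(ccone_iter_ddP P e) => j; rewrite leq_eqVlt => /predU1P[<-|ij].
    have := mulr_gt0 t0 Bt; rewrite -[X in X * _]hornerX -hornerM -Lx horner_lin.
    by rewrite (polyfun_iter_dd _ _ _ e) pmulrn_lgt0 ?fact_gt0 // => /ltW.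
  have [jn|nj] := leqP j n; last by rewrite (coef_lin_gt Ph Pe).
  apply/ltW; apply: ((@ocone_iter_ddP _ _ _ _ _ Ph Pe i.+1 (ltnW lt_in) _).1 Ot).
  by rewrite ij.
by case: Ox => _ xmin /xmin; rewrite cL lerDl pmulr_rge0.
Qed.

Let euler : polyfun (dd x q) x = 0.
Proof.
rewrite polyfun_dd; suff -> : lin q x x = 0 by rewrite coef0.
apply: (@poly_eq0_except _ _ 0) => s _.
by rewrite horner_lin -{1}[x]scale1r -scalerDl (polyfunZ _ _ qh) qx mulr0.
Qed.

Let dq v a w : polyfun (dd (v + a *: w) q) x =
  polyfun (dd v q) x + a * polyfun (dd w q) x.
Proof. by rewrite dd_linear polyfunD polyfunZl. Qed.

(* The multiplier is found by testing with [e - x], for which Euler's identity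
   gives [D q x (e - x) = q' x]. *)
Lemma lagrange v : A v = 0 ->
  c v * polyfun q' x = c (e - x) * polyfun (dd v q) x.
Proof.
move=> Av.
have cge0 u : A u = 0 -> polyfun (dd u q) x = 0 -> 0 <= c u.
  move=> Au qu; rewrite leNgt; apply/negP => cu.
  (* Tilts [u] inward by so little that [c] still takes the negative value [c u / 2]. *)
  pose a := - c u / (2 * c (e - x)).
  have a0 : 0 < a by rewrite divr_gt0 ?oppr_gt0 // mulr_gt0.
  have : 0 <= c (u + a *: (e - x)).
    apply: ascent; first by rewrite AL linearB Ae Ax Au subrr scaler0 addr0.
    rewrite dq qu add0r mulr_gt0 // -scaleN1r dq euler mulr0 addr0.
    exact: q'x.
  rewrite cL /a invfM mulrA divfK ?gt_eqF //; lra.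
have cq0 u : A u = 0 -> polyfun (dd u q) x = 0 -> c u = 0.
  move=> Au qu; apply/le_anti; rewrite cge0 // andbT -oppr_ge0 -linearN.
  apply: cge0; first by rewrite linearN Au oppr0.
  have := dq 0 (-1) u; rewrite add0r scaleN1r => ->.
  have := dq 0 0 u; rewrite qu !mulr0 !addr0.
  have := dq 0 1 0; rewrite scaler0 addr0 mul1r.
  by move/eqP; rewrite -subr_eq0 opprD addrA subrr sub0r oppr_eq0 => /eqP.
pose a := - polyfun (dd v q) x / polyfun q' x.
have := cq0 (v + a *: (e - x)).
rewrite AL linearB Ae Ax Av subrr scaler0 addr0 dq -scaleN1r dq euler.
rewrite mulr0 addr0 divfK ?gt_eqF // subrr => /(_ erefl erefl).
rewrite cL /a scaleN1r => /eqP; rewrite addr_eq0 => /eqP ->.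
by rewrite !mulNr opprK mulrAC divfK ?gt_eqF // mulrC.
Qed.

(* Split [v = w + a e] with [w] tangent to [q = 0] at [x]: the expression equals
   [q' x (D_w^2 q x - a^2 D_e^2 q x)]. *)
Lemma ratio_second_order v : ~ (exists a, v = a *: x) ->
  polyfun (dd v (dd v q)) x * polyfun q' x -
  2 * polyfun (dd v q) x * polyfun (dd v q') x < 0.
Proof.
move=> nv; pose N := polyfun q' x; pose a := polyfun (dd v q) x / N.
have E0 : 0 < polyfun (dd e q') x.
  rewrite -[dd e q']/(iter i.+2 (dd e) P) (polyfun_iter_dd _ _ _ e).
  rewrite pmulrn_lgt0 ?fact_gt0 //.
  apply: ((@ocone_iter_ddP _ _ _ _ _ Ph Pe i.+1 (ltnW lt_in) _).1 O'x).
  by rewrite leqnSn.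
pose w := v + (- a) *: e.
have aN : a * N = polyfun (dd v q) x by rewrite divfK // gt_eqF.
have qw : polyfun (dd w q) x = 0.
  by rewrite dq mulNr -[polyfun (dd e q) x]/N aN subrr.
have qww := tangent_second_order qh qe Cx qx q'x qw.
have qwwE : polyfun (iter 2 (dd w) q) x = polyfun (dd v (dd v q)) x -
    2 * a * polyfun (dd v q') x + a ^+ 2 * polyfun (dd e q') x.
  rewrite /= !dd_linear !dd_is_linear !(polyfunD, polyfunZl).
  by rewrite [dd e (dd v q)]dd_comm -/q'; ring.
rewrite -aN -/N.
have -> : polyfun (dd v (dd v q)) x * N - 2 * (a * N) * polyfun (dd v q') x =
    N * polyfun (iter 2 (dd w) q) x - N * (a ^+ 2 * polyfun (dd e q') x).
  by rewrite qwwE; ring.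
have N0 : 0 < N by [].
(* If [a] is nonzero, its square gives strictness. Otherwise [v] is tangent, and equality would
   yield a line of zeros of [q] along [v]. *)
have [a0|a0] := eqVneq a 0; last first.
  have a2 : 0 < a ^+ 2 by rewrite lt_def sqrf_eq0 a0 sqr_ge0.
  rewrite subr_lt0; apply: (@le_lt_trans _ _ 0); first by rewrite pmulr_rle0.
  exact: mulr_gt0 N0 (mulr_gt0 a2 E0).
rewrite a0 expr0n mul0r mulr0 subr0 pmulr_rlt0 // lt_neqAle qww andbT.
apply/eqP => qww0; apply: nv.
have wv : w = v by rewrite /w a0 oppr0 scale0r addr0.
rewrite -wv; apply: (zero_line_radial Ph Pe pointed lt_in Cx nCx).
exact: (tangent_line qh qe Cx qx q'x qw qww0).
Qed.

Let f y : R := - ln (c (e - y)) - polyfun q y / polyfun q' y.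
Let dom := [set y | ocone q' e y /\ 0 < c (e - y)].
Let gapL v : {poly R} := (c (e - x))%:P - c v *: 'X.

Let gapLE v s : (gapL v).[s] = c (e - (x + s *: v)).
Proof.
rewrite /gapL hornerD hornerN hornerC hornerZ hornerX.
by rewrite opprD addrA -[- (s *: v)]scaleNr cL mulNr mulrC.
Qed.

Let f_line v s : f (x + s *: v) = barrier (gapL v) (lin q x v) (lin q' x v) s.
Proof. by rewrite /f /barrier gapLE !horner_lin. Qed.

Let lin0 Q v : (lin Q x v).[0] = polyfun Q x.
Proof. by rewrite horner_lin scale0r addr0. Qed.

Let gapL0 v : (gapL v).[0] = c (e - x).
Proof. by rewrite gapLE scale0r addr0. Qed.

Let gapL1 v : (gapL v)^`().[0] = - c v.
Proof.
by rewrite derivB derivC derivZ derivX sub0r hornerN hornerZ hornerC mulr1.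
Qed.

Let gapL2 v : (gapL v)^`()^`().[0] = 0.
Proof.
rewrite derivB derivC derivZ derivX sub0r derivN derivZ derivC scaler0.
by rewrite oppr0 hornerC.
Qed.

Let curv v := (c v) ^+ 2 / c (e - x) ^+ 2 -
  (polyfun (dd v (dd v q)) x * polyfun q' x -
   2 * polyfun (dd v q) x * polyfun (dd v q') x) / polyfun q' x ^+ 2.

Let curv_gt0 v : ~ (exists a, v = a *: x) -> 0 < curv v.
Proof.
move=> nv; rewrite /curv ltr_pwDr //.
  by rewrite oppr_gt0 pmulr_llt0 ?invr_gt0 ?exprn_gt0 // ratio_second_order.
by rewrite divr_ge0 ?sqr_ge0.
Qed.

Lemma D2_swath_fun_gt0 v : ~ (exists a, v = a *: x) -> 0 < D2 f x v.
Proof.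
move=> nv; suff -> : D2 f x v = curv v by exact: curv_gt0.
rewrite /D2 /dirD /=.
have := derive_line (fun y => 'D_v (f : _ -> R^o) y) x v 0.
rewrite scale0r addr0 => ->.
have -> : (fun u : R => 'D_v (f : _ -> R^o) (x + u *: v)) =
    (fun u : R => 'D_1 (barrier (gapL v) (lin q x v) (lin q' x v) : R -> R^o) u).
  apply/funext => u; rewrite derive_line; congr ('D_1 _ u).
  by apply/funext => s; rewrite f_line.
rewrite derive2_barrier ?gapL0 ?lin0 //.
by rewrite gapL1 gapL2 -!lin_dd !lin0 mul0r subr0 sqrrN.
Qed.

Lemma optimum_in_swath_dom : dom x.
Proof. by split. Qed.

Lemma swath_dom_convex (t : R) y z : 0 < t -> t < 1 -> dom y -> dom z ->
  dom (t *: y + (1 - t) *: z).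
Proof.
move=> t0 t1 [Oy cy] [Oz cz]; have u0 : 0 < 1 - t by rewrite subr_gt0.
split.
  by apply: (ocone_add q'h q'e); apply: (ocone_scale q'h).
have -> : e - (t *: y + (1 - t) *: z) = t *: (e - y) + (1 - t) *: (e - z).
  by rewrite !scalerBr addrACA -scalerDl subrKC scale1r -opprD.
by rewrite cL linearZ addr_gt0 // mulr_gt0.
Qed.

Lemma swath_fun_convex (t : R) y z : 0 < t -> t < 1 -> dom y -> dom z ->
  f (t *: y + (1 - t) *: z) <= t * f y + (1 - t) * f z.
Proof.
move=> t0 t1 [Oy cy] [Oz cz]; have u0 : 0 < 1 - t by rewrite subr_gt0.
have qh1 : homogeneous (n - i.+1).+1 q by rewrite subnSK // ltnW.
have := ratio_superadd qh1 qe (ocone_scale q'h t0 Oy) (ocone_scale q'h u0 Oz).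
rewrite !(ratioZ e qh1) -/q' => rat.
have -> : f (t *: y + (1 - t) *: z) = - ln (t * c (e - y) + (1 - t) * c (e - z))
   - polyfun q (t *: y + (1 - t) *: z) / polyfun q' (t *: y + (1 - t) *: z).
  rewrite /f; congr (- ln _ - _).
  have -> : e - (t *: y + (1 - t) *: z) = t *: (e - y) + (1 - t) *: (e - z).
    by rewrite !scalerBr addrACA -scalerDl subrKC scale1r -opprD.
  by rewrite cL linearZ.
have ti : 0 <= t <= 1 by rewrite !ltW.
have := @concave_ln R (Itv01 (ltW t0) (ltW t1)) _ _ cy cz.
rewrite !convRE /= /unstable.onem => lnc.
rewrite /f; lra.
Qed.

(** Convexity propagates a local fact: [f] exceeds [f x] at some [x + s v] between [x] and [y],
    hence also at [y]. *)
Lemma swath_fun_strict_min y : dom y -> A y = b -> y != x -> f x < f y.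
Proof.
move=> Dy Ay yx; pose v := y - x.
have Av : A v = 0 by rewrite linearB Ay Ax subrr.
have v0 : v != 0 by rewrite subr_eq0.
have nv := not_multiple Ax Av v0.
have [||||s [s0 s1 fs]] := @strict_increase R
  (barrier (gapL v) (lin q x v) (lin q' x v))
  (barrier1 (gapL v) (lin q x v) (lin q' x v)) (curv v).
(* As [q x = 0], the slope at 0 is [c v / c (e - x) - D_v q x / q' x], which is 0 by [lagrange]. *)
- rewrite /barrier1 gapL0 gapL1 horner_exp hornerD hornerN !hornerM.
  rewrite -!lin_dd !lin0 qx mul0r subr0 expr2 invfM mulrA mulfK ?gt_eqF //.
  rewrite mulNr opprK; apply/eqP; rewrite subr_eq0; apply/eqP.
  apply: (mulIf (_ : c (e - x) * polyfun q' x != 0)).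
    by rewrite mulf_neq0 // gt_eqF.
  by rewrite mulrA divfK ?gt_eqF // (lagrange Av) mulrCA divfK ?gt_eqF.
- exact: curv_gt0.
- rewrite /curv; have := @is_derive_barrier1 R (gapL v) (lin q x v) (lin q' x v).
  rewrite gapL0 gapL1 gapL2 -!lin_dd !lin0 mul0r subr0 sqrrN; exact.
- have L0 : 0 < (gapL v).[0] by rewrite gapL0.
  have N0 : 0 < (lin q' x v).[0] by rewrite lin0.
  by near=> t; apply: is_derive_barrier; near: t; exact: poly_gt0_near.
have Dx := optimum_in_swath_dom.
have u0 : 0 < 1 - s by rewrite subr_gt0.
have := swath_fun_convex s0 s1 Dy Dx.
have -> : s *: y + (1 - s) *: x = x + s *: v.
  by rewrite scalerBr scalerBl scale1r addrC addrAC addrA.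
rewrite f_line => fle; rewrite -!f_line scale0r addr0 in fs fle.
rewrite -(ltr_pM2l s0); have := lt_le_trans fs fle; lra.
Unshelve. all: by end_near. Qed.

End AtOptimum.
End Program.

Theorem corollary9 (R : realType) (d m n : nat)
    (P : mpoly d R) (e0 : 'rV[R]_d)
    (A : {linear 'rV[R]_d -> 'rV[R]_m}) (b : 'rV[R]_m)
    (c : {linear 'rV[R]_d -> R^o})
    (P_homog : homogeneous n P)
    (P_hyp : hyperbolic P e0)
    (cone_regular : regular_cone (closed_cone (polyfun P) e0))
    (A_surj : forall y : 'rV[R]_m, exists x : 'rV[R]_d, A x = y)
    (b_neq0 : b != 0)
    (c_notin_imA : ~ exists y : {linear 'rV[R]_m -> R^o},
        forall x : 'rV[R]_d, c x = y (A x))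
    (i : nat) (i_ge1 : (1 <= i)%N) (i_le : (i <= n - 2)%N)
    (e : 'rV[R]_d)
    (e_in : (Swath (polyfun P) e0 A b c i `\` Core (polyfun P) e0 A b c i) e)
    (x : 'rV[R]_d) (x_opt : OptD (polyfun P) A b c i e x) :
  let p := polyfun P in
  let f := swath_fun p c i e in
  let dom := swath_dom p c i e in
  [/\ convex_set dom,
      convex_function dom f,
      optimal f (dom `&` [set y | A y = b]) = [set x],
      (forall v : 'rV[R]_d, ~ (exists a : R, v = a *: x) -> 0 < D2 f x v) &
      (forall v : 'rV[R]_d, v != 0 -> A v = 0 -> 0 < D2 f x v)].
Proof.
have lt_in : (i.+1 < n)%N.
  (* The subtraction is truncated, so [2 < n] is derived before [i + 2 <= n]. *)
  have n2 : (0 < n - 2)%N := leq_trans i_ge1 i_le.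
  by rewrite -addn2 -(subnK (ltnW (_ : (2 < n)%N))) ?leq_add2r // -subn_gt0.
have [eS eC] := e_in; have [Ce Ae _] := eS.
have Pe : hyperbolic P e.
  by apply: (garding_direction P_homog P_hyp); rewrite -(open_coneE P_homog P_hyp).
have coneE : closed_cone (polyfun P) e0 = ccone P e.
  rewrite -(closed_coneE P_homog Pe) /closed_cone; congr closure.
  exact: same_connected_component.
have pointed z : (forall a, ccone P e (a *: z)) -> z = 0.
  move=> Cz; have [_ /(_ <[z]>%VS)] := cone_regular.
  rewrite coneE => H; apply/eqP; rewrite -memv0 -H ?memv_line //.
  by move=> y /vlineP[a ->].
have qh k := iter_dd_homog k e P_homog.
have qe k : (k <= n)%N -> hyperbolic (iter k (dd e) P) e.
  exact: (hyperbolic_iter_dd P_homog Pe).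
have OptDE : OptD (polyfun P) A b c i e =
    optimal c [set y | A y = b /\ ccone (iter i (dd e) P) e y].
  rewrite /OptD dirD_polyfun (closed_coneE (qh i)) //.
  by apply: qe; rewrite ltnW // ltnW.
have OptE : Opt (polyfun P) e0 A b c =
    optimal c [set y | A y = b /\ ccone P e y] by rewrite /Opt coneE.
have Opt_neq : OptD (polyfun P) A b c i e <> Opt (polyfun P) e0 A b c.
  by move=> OO; apply: eC.
rewrite OptDE OptE in Opt_neq; rewrite OptDE in x_opt.
have domE : swath_dom (polyfun P) c i e =
    [set y | ocone (dd e (iter i (dd e) P)) e y /\ 0 < c (e - y)].
  rewrite /swath_dom dirD_polyfun (open_coneE (qh i.+1)) //.
  exact: (qe i.+1 (ltnW lt_in)).
have fE : swath_fun (polyfun P) c i e = fun y => - ln (c (e - y)) -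
    polyfun (iter i (dd e) P) y / polyfun (dd e (iter i (dd e) P)) y.
  by apply/funext => y; rewrite /swath_fun !dirD_polyfun.
move=> p f dom; rewrite /f /dom {f dom} /p {p} domE fE.
set dom := [set y | _]; set f := fun y => _.
have D2_gt0 v : ~ (exists a : R, v = a *: x) -> 0 < D2 f x v.
  exact: (D2_swath_fun_gt0 P_homog Pe pointed lt_in A_surj b_neq0
            c_notin_imA Ae Opt_neq x_opt).
have Ax : A x = b by case: x_opt => [[]].
have Dx : dom x.
  exact: (optimum_in_swath_dom P_homog Pe pointed lt_in A_surj b_neq0
            c_notin_imA Ae Opt_neq x_opt).
have fmin y : dom y -> A y = b -> y != x -> f x < f y.
  exact: (swath_fun_strict_min P_homog Pe pointed lt_in A_surj b_neq0
            c_notin_imA Ae Opt_neq x_opt).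
split=> //.
- apply/convex_setW => y z; rewrite !inE => Dy Dz k k0 k1; rewrite inE.
  exact: (swath_dom_convex P_homog Pe lt_in k0 k1 Dy Dz).
- move=> k y z; rewrite !inE => Dy Dz.
  (* The endpoints are treated apart because the open cone is stable only under positive scaling. *)
  have [->|k0] := eqVneq k 0%:i01; first by rewrite !conv0.
  have [->|k1] := eqVneq k 1%:i01; first by rewrite !conv1.
  have k0' : 0 < k%:num by rewrite lt_neqAle eq_sym k0 ge0.
  have k1' : k%:num < 1 by rewrite lt_neqAle k1 le1.
  exact: (swath_fun_convex P_homog Pe lt_in k0' k1' Dy Dz).
- apply/seteqP; split=> [y [[Dy Ay] ymin]|_ ->].
    apply: contrapT => /eqP yx; have := fmin y Dy Ay yx.
    by rewrite ltNge ymin.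
  split=> // y [Dy Ay]; have [->//|yx] := eqVneq y x.
  by rewrite ltW // fmin.
- by move=> v v0 Av; apply: D2_gt0; exact: (not_multiple b_neq0 Ax Av v0).
Qed.
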